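(* Let $G$ be a compact Lie group with a closed normal subgroup $N$, with Lie algebras $\mathfrak g$ and $\mathfrak n$. Let $(\tilde M,\tilde\omega)$ be a symplectic manifold with a hamiltonian $G$-action with momentum map $\mu\colon\tilde M\to\mathfrak g^*$. Let $\tilde c\in\mathfrak g^*$ be invariant under the coadjoint action of $G$, let $\mu_N=i^*\circ\mu\colon\tilde M\to\mathfrak n^*$, where $i\colon\mathfrak n\to\mathfrak g$ is the inclusion, and suppose that $c=i^*(\tilde c)$ is a regular value of $\mu_N$ such that the action of $N$ on $\mu_N^{-1}(c)$ is locally free. Assume additionally that $G$ acts freely on $\tilde M$ and that the dimension of $G$ is equal to half the dimension of $\tilde M$, so that $\mu\colon\tilde M\to\mathfrak g^*$ is a $G$-principal bundle over its image. Let $\tilde g$ be a $G$-invariant compatible Kähler metric on $\tilde M$ (i.e. with Kähler form $\tilde\omega$). Then there is a uniquely defined riemannian metric $\tilde g_{\rm red}$ on ${\rm im}\,\mu$ such that $\mu$ is a riemannian submersion from $\tilde g$ to $\tilde g_{\rm red}$. Similarly, $G/N$ acts freely on the Kähler quotient $M=\mu_N^{-1}(c)/N$; this makes its momentum map $\nu\colon M\to(\mathfrak g/\mathfrak n)^*$ into a $G/N$-principal bundle over its image, and $\nu$ is a riemannian submersion for a uniquely defined riemannian metric $g_{\rm red}$ on ${\rm im}\,\nu$, when $M$ is equipped with the metric $g$ induced by $\tilde g$. Let $\ell=u^*+\tilde c$ be the affine map from ${\rm im}\,\nu$ to ${\rm im}\,\mu$ induced by the natural inclusion $u^*\colon(\mathfrak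 g/\mathfrak n)^*\to\mathfrak g^*$. Then the reduced metrics are related by $$\ell^*\tilde g_{\rm red}=g_{\rm red}.$$
   Context: **Hamiltonian actions.** A momentum map $\mu\colon\tilde M\to\mathfrak g^*$ is a $G$-equivariant map with $\iota_{X_\xi}\tilde\omega=-\langle d\mu,\xi\rangle$ for all $\xi\in\mathfrak g$, where $X_\xi$ is the vector field generated by $\xi$. **Quotient.** Let $q\colon\mu_N^{-1}(c)\to M=\mu_N^{-1}(c)/N$ be the projection. $M$ carries the symplectic form $\omega$ with $q^*\omega=\tilde\omega|_{\mu_N^{-1}(c)}$ and the metric $g$ making $q$ a riemannian submersion, where $\mu_N^{-1}(c)$ has the metric induced by $\tilde g$. The group $G/N$ acts on $M$ by $[h]\cdot[z]=[h\cdot z]$. Identify $(\mathfrak g/\mathfrak n)^*$ with the annihilator of $\mathfrak n$ in $\mathfrak g^*$ via $u^*$, the adjoint of the projection $u\colon\mathfrak g\to\mathfrak g/\mathfrak n$. The momentum map $\nu$ of the $G/N$-action is given by $\nu\circ q=(\mu-\tilde c)|_{\mu_N^{-1}(c)}$, i.e. $\ell(\nu(q(z)))=\mu(z)$ for $z\in\mu_N^{-1}(c)$.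
   Formalization: That μ is a G-principal bundle over its image is assumed, not deduced from freeness and dim G = ½ dim M̃: the deduction fails in general, e.g. for left translations of SU(2) on T*SU(2), where μ is not constant on G-orbits. *)

(* Defs.v *)
From HB Require Import structures.
From mathcomp Require Import all_boot all_order all_algebra.
From mathcomp Require Import all_classical all_reals all_analysis.

Set Implicit Arguments.
Unset Strict Implicit.
Unset Printing Implicit Defensive.

Import Order.TTheory GRing.Theory Num.Theory.
Import numFieldNormedType.Exports.

Local Open Scope classical_set_scope.
Local Open Scope ring_scope.

(* [U] is meant to be open and [V], [W] finite dimensional; [f] is then C^k on
   [U] iff it is differentiable with all its directional derivatives C^(k-1). *)
Fixpoint Ck_on (R : realType) (V W : normedModType R) (k : nat)
    (U : set V) (f : V -> W) : Prop :=
  match k with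
  | 0 => forall x, U x -> {for x, continuous f}
  | k'.+1 => (forall x, U x -> differentiable f x) /\
             (forall v, Ck_on k' U (fun x => 'd f x v))
  end.

Definition smooth_on (R : realType) (V W : normedModType R)
    (U : set V) (f : V -> W) : Prop := forall k, Ck_on k U f.

(* [cmap] is only meaningful on [cdom], and [cinv] on [cmap @` cdom]. *)
Record chart (R : realType) (E : normedModType R) (M : topologicalType) := Chart {
  cdom : set M;
  cmap : M -> E;
  cinv : E -> M }.

(* A space with charts in [E] and, for each point, a preferred chart
   [chart_at p] of the atlas.  The tangent space at [p] is [E]: a tangent vector
   is represented by its coordinates in the chart [chart_at p]. *)
Record charted (R : realType) (E : normedModType R) := Charted {
  csort :> topologicalType;
  atlas : set (chart E csort);
  chart_at : csort -> chart E csort }.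

Arguments atlas {R E} M _ : rename.

Definition charted_vec (R : realType) (E : normedModType R) : charted E :=
  @Charted R E E [set @Chart R E E setT id id] (fun=> @Chart R E E setT id id).

Definition prod_chart (R : realType) (E1 E2 : normedModType R)
    (M1 M2 : topologicalType) (c1 : chart E1 M1) (c2 : chart E2 M2) :
    chart (E1 * E2)%type (M1 * M2)%type :=
  @Chart R (E1 * E2)%type (M1 * M2)%type
    (cdom c1 `*` cdom c2)
    (fun p => (cmap c1 p.1, cmap c2 p.2))
    (fun x => (cinv c1 x.1, cinv c2 x.2)).

Definition charted_prod (R : realType) (E1 E2 : normedModType R)
    (M1 : charted E1) (M2 : charted E2) : charted (E1 * E2)%type :=
  @Charted R (E1 * E2)%type (M1 * M2)%type
    [set c | exists c1 c2,
       [/\ atlas M1 c1, atlas M2 c2 & c = prod_chart c1 c2]]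
    (fun p => prod_chart (chart_at p.1) (chart_at p.2)).

Record is_chart (R : realType) (E : normedModType R) (M : topologicalType)
    (c : chart E M) : Prop := IsChart {
  cdom_open : open (cdom c);
  cimg_open : open (cmap c @` cdom c);
  cmapK : forall p, cdom c p -> cinv c (cmap c p) = p;
  cmap_cont : forall p, cdom c p -> {for p, continuous (cmap c)};
  cinv_cont : forall x, (cmap c @` cdom c) x -> {for x, continuous (cinv c)} }.

Record manifold (R : realType) (n : nat) := Manifold {
  mcharted :> charted 'rV[R]_n;
  mhausdorff : hausdorff_space mcharted;
  mcountable : @second_countable mcharted;
  mchart : forall c, atlas mcharted c -> is_chart c;
  mcompat : forall c c', atlas mcharted c -> atlas mcharted c' ->
    smooth_on (cmap c @` (cdom c `&` cdom c')) (cmap c' \o cinv c);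
  mchart_at : forall p : mcharted,
    atlas mcharted (chart_at p) /\ cdom (chart_at p) p }.

(* [U] is meant to be open. *)
Definition msmooth_on (R : realType) (E E' : normedModType R)
    (M : charted E) (M' : charted E') (U : set M) (f : M -> M') : Prop :=
  (forall p, U p -> {for p, continuous f}) /\
  (forall c c', atlas M c -> atlas M' c' ->
     smooth_on (cmap c @` (U `&` cdom c `&` f @^-1` cdom c'))
               (cmap c' \o f \o cinv c)).

Definition msmooth (R : realType) (E E' : normedModType R)
    (M : charted E) (M' : charted E') (f : M -> M') : Prop :=
  msmooth_on setT f.

(* The tangent map T_p M -> T_(f p) M'. *)
Definition mdiff (R : realType) (E E' : normedModType R)
    (M : charted E) (M' : charted E') (f : M -> M') (p : M) : E -> E' :=
  'd (cmap (chart_at (f p)) \o f \o cinv (chart_at p)) (cmap (chart_at p) p).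

Definition submersion (R : realType) (E E' : normedModType R)
    (M : charted E) (M' : charted E') (f : M -> M') : Prop :=
  msmooth f /\ forall p w, exists v, mdiff f p v = w.

Record embedding (R : realType) (E E' : normedModType R)
    (M : charted E) (M' : charted E') (f : M -> M') : Prop := Embedding {
  emb_smooth : msmooth f;
  emb_inj : injective f;
  emb_immersion : forall p, injective (mdiff f p);
  emb_top : forall U : set M, open U ->
    exists2 V : set M', open V & U = f @^-1` V }.

Definition diffeo_on (R : realType) (E E' : normedModType R)
    (M : charted E) (M' : charted E') (U : set M) (U' : set M')
    (f : M -> M') (f' : M' -> M) : Prop :=
  [/\ open U /\ open U',
      (forall p, U p -> U' (f p) /\ f' (f p) = p),
      (forall p, U' p -> U (f' p) /\ f (f' p) = p),
      msmooth_on U f & msmooth_on U' f'].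

Definition tensor2 (R : realType) (E : normedModType R) (M : charted E) :=
  M -> E -> E -> R.

Definition pullback (R : realType) (E E' : normedModType R)
    (M : charted E) (M' : charted E') (f : M -> M') (T : tensor2 M') :
    tensor2 M :=
  fun p v w => T (f p) (mdiff f p v) (mdiff f p w).

(* The expression of [T] in the chart [c]. *)
Definition in_chart (R : realType) (E : normedModType R) (M : charted E)
    (T : tensor2 M) (c : chart E M) : E -> E -> E -> R :=
  @pullback R E E (charted_vec E) M (cinv c) T.

Definition smooth_tensor_on (R : realType) (E : normedModType R)
    (M : charted E) (B : set M) (T : tensor2 M) : Prop :=
  forall c, atlas M c -> forall v w : E,
    smooth_on (cmap c @` (B `&` cdom c)) (fun x => in_chart T c x v w : R^o).

Definition bilinear_form (R : realType) (E : normedModType R)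
    (b : E -> E -> R) : Prop :=
  (forall (a : R) u v w, b (a *: u + v) w = a * b u w + b v w) /\
  (forall (a : R) u v w, b w (a *: u + v) = a * b w u + b w v).

(* [B] is meant to be open. *)
Record riemannian_metric_on (R : realType) (E : normedModType R)
    (M : charted E) (B : set M) (g : tensor2 M) : Prop := RiemannianMetricOn {
  rm_bilinear : forall p, B p -> bilinear_form (g p);
  rm_sym : forall p, B p -> forall v w, g p v w = g p w v;
  rm_pos : forall p, B p -> forall v, v != 0 -> 0 < g p v v;
  rm_smooth : smooth_tensor_on B g }.

Definition riemannian_metric (R : realType) (E : normedModType R)
    (M : charted E) (g : tensor2 M) : Prop := riemannian_metric_on setT g.

(* [sf_closed] is the coordinate expression of d omega (u, v, w) = 0, for
   constant vectors u, v, w. *)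
Record symplectic_form (R : realType) (E : normedModType R)
    (M : charted E) (omega : tensor2 M) : Prop := SymplecticForm {
  sf_bilinear : forall p, bilinear_form (omega p);
  sf_alt : forall p v, omega p v v = 0;
  sf_nondeg : forall p v, (forall w, omega p v w = 0) -> v = 0;
  sf_smooth : smooth_tensor_on setT omega;
  sf_closed : forall c, atlas M c -> forall x, (cmap c @` cdom c) x ->
    forall u v w : E,
      'D_u (fun y => in_chart omega c y v w : R^o) x
      + 'D_v (fun y => in_chart omega c y w u : R^o) x
      + 'D_w (fun y => in_chart omega c y u v : R^o) x = 0 }.

Definition complex_space (R : realType) (m : nat) :
    charted ('rV[R]_m * 'rV[R]_m)%type :=
  charted_vec ('rV[R]_m * 'rV[R]_m)%type.

(* Multiplication by the imaginary unit, (x, y) standing for x + iy. *)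
Definition mult_i (R : realType) (m : nat) (z : 'rV[R]_m * 'rV[R]_m) :
    'rV[R]_m * 'rV[R]_m := (- z.2, z.1).

(* [J] is the almost complex structure of a complex manifold: around every point
   there are coordinates with values in C^m whose differentials are
   complex linear. *)
Record complex_structure (R : realType) (E : normedModType R)
    (M : charted E) (J : M -> E -> E) : Prop := ComplexStructure {
  cs_linear : forall p (a : R) u v, J p (a *: u + v) = a *: J p u + J p v;
  cs_sqr : forall p v, J p (J p v) = - v;
  cs_integrable : forall p, exists (m : nat) (U : set M)
      (W : set (complex_space R m))
      (f : M -> complex_space R m) (f' : complex_space R m -> M),
    [/\ U p, diffeo_on U W f f' &
        forall p', U p' -> forall v,
          mdiff f p' (J p' v) = mult_i (mdiff f p' v)] }.

Definition kahler_metric (R : realType) (E : normedModType R)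
    (M : charted E) (omega g : tensor2 M) : Prop :=
  riemannian_metric g /\
  exists2 J : M -> E -> E, complex_structure J &
    forall p v w, omega p v w = g p (J p v) w.

Definition horizontal (R : realType) (E E' : normedModType R)
    (M : charted E) (M' : charted E') (g : tensor2 M) (f : M -> M')
    (p : M) (v : E) : Prop :=
  forall w, mdiff f p w = 0 -> g p v w = 0.

(* Only the values of [h] at the points of the image of [f] matter. *)
Definition riemannian_submersion (R : realType) (E E' : normedModType R)
    (M : charted E) (M' : charted E') (g : tensor2 M) (h : tensor2 M')
    (f : M -> M') : Prop :=
  submersion f /\
  forall p v w, horizontal g f p v -> horizontal g f p w ->
    h (f p) (mdiff f p v) (mdiff f p w) = g p v w.

(* [h] is a metric on the image of [f] (an open subset of [M']) making [f] a
   riemannian submersion onto its image. *)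
Definition reduced_metric (R : realType) (E E' : normedModType R)
    (M : charted E) (M' : charted E') (g : tensor2 M) (f : M -> M')
    (h : tensor2 M') : Prop :=
  riemannian_metric_on (range f) h /\ riemannian_submersion g h f.

Definition unique_reduced_metric (R : realType) (E E' : normedModType R)
    (M : charted E) (M' : charted E') (g : tensor2 M) (f : M -> M') : Prop :=
  exists2 h, reduced_metric g f h &
    forall h', reduced_metric g f h' ->
      forall y, range f y -> forall v w, h' y v w = h y v w.

Record lieGroup (R : realType) (d : nat) := LieGroup {
  lmanifold :> manifold R d;
  lone : lmanifold;
  lmul : lmanifold -> lmanifold -> lmanifold;
  linv : lmanifold -> lmanifold;
  lmulA : associative lmul;
  lmul1 : left_id lone lmul;
  lmulV : left_inverse lone linv lmul;
  lmul_smooth :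
    msmooth (fun x : charted_prod lmanifold lmanifold => lmul x.1 x.2);
  linv_smooth : msmooth linv }.

Arguments lone {R d}.

(* The Lie algebra of [G : lieGroup R d] is the tangent space [ 'rV[R]_d ] at
   [lone G]; its dual is the space [ 'cV[R]_d ] of linear forms. *)
Definition pairing (R : realType) (d : nat) (a : 'cV[R]_d) (xi : 'rV[R]_d) : R :=
  (xi *m a) 0 0.

(* The adjoint of a linear map [f]. *)
Definition dual_map (R : realType) (d e : nat) (f : 'rV[R]_d -> 'rV[R]_e)
    (a : 'cV[R]_e) : 'cV[R]_d :=
  \col_i pairing a (f (delta_mx 0 i)).

Definition dual (R : realType) (d : nat) : charted 'cV[R]_d :=
  charted_vec 'cV[R]_d.

Record lie_hom (R : realType) (d e : nat) (G : lieGroup R d) (H : lieGroup R e)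
    (f : G -> H) : Prop := LieHom {
  lh_smooth : msmooth f;
  lh_mul : forall x y, f (lmul x y) = lmul (f x) (f y) }.

Definition lie_map (R : realType) (d e : nat) (G : lieGroup R d)
    (H : lieGroup R e) (f : G -> H) : 'rV[R]_d -> 'rV[R]_e :=
  mdiff f (lone G).

Record closed_normal_subgroup (R : realType) (d n : nat) (G : lieGroup R d)
    (N : lieGroup R n) (i : N -> G) : Prop := ClosedNormalSubgroup {
  cns_hom : lie_hom i;
  cns_emb : embedding i;
  cns_closed : closed (range i);
  cns_normal : forall g x, range i x -> range i (lmul (lmul g x) (linv g)) }.

(* [K] is the quotient Lie group of [G] by the image of [i], with projection
   [pi]: its Lie algebra is g/n, and the differential of [pi] at the unit is the
   projection u of g onto g/n. *)
Record quotient_group (R : realType) (d n k : nat) (G : lieGroup R d)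
    (N : lieGroup R n) (K : lieGroup R k) (i : N -> G) (pi : G -> K) : Prop :=
  QuotientGroup {
  qg_hom : lie_hom pi;
  qg_submersion : submersion pi;
  qg_surj : range pi = setT;
  qg_ker : forall g, pi g = lone K <-> range i g }.

Definition Ad (R : realType) (d : nat) (G : lieGroup R d) (g : G) :
    'rV[R]_d -> 'rV[R]_d :=
  mdiff (fun h : G => lmul (lmul g h) (linv g) : G) (lone G).

Definition coAd (R : realType) (d : nat) (G : lieGroup R d) (g : G) :
    'cV[R]_d -> 'cV[R]_d :=
  dual_map (Ad (linv g)).

Record smooth_action (R : realType) (d : nat) (E : normedModType R)
    (G : lieGroup R d) (M : charted E) (act : G -> M -> M) : Prop :=
  SmoothAction {
  sa_one : forall p, act (lone G) p = p;
  sa_mul : forall g h p, act (lmul g h) p = act g (act h p);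
  sa_smooth : msmooth (fun x : charted_prod G M => act x.1 x.2 : M) }.

Definition free_action (R : realType) (d : nat) (E : normedModType R)
    (G : lieGroup R d) (M : charted E) (act : G -> M -> M) : Prop :=
  forall g p, act g p = p -> g = lone G.

(* Discrete stabilisers at the points of [S]. *)
Definition locally_free_on (R : realType) (d : nat) (E : normedModType R)
    (G : lieGroup R d) (M : charted E) (S : set M) (act : G -> M -> M) : Prop :=
  forall p, S p -> exists2 U : set G, open U /\ U (lone G) &
    forall g, U g -> act g p = p -> g = lone G.

Definition invariant_tensor (R : realType) (d : nat) (E : normedModType R)
    (G : lieGroup R d) (M : charted E) (act : G -> M -> M) (T : tensor2 M) :
    Prop :=
  forall g, pullback (act g) T = T.

(* X_xi(p) = d/dt exp(t xi).p at t = 0, the image of [xi] under the differential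
   of the orbit map at the unit. *)
Definition generated_field (R : realType) (d : nat) (E : normedModType R)
    (G : lieGroup R d) (M : charted E) (act : G -> M -> M)
    (xi : 'rV[R]_d) (p : M) : E :=
  mdiff (fun g : G => act g p : M) (lone G) xi.

Record hamiltonian_action (R : realType) (d : nat) (E : normedModType R)
    (G : lieGroup R d) (M : charted E) (omega : tensor2 M)
    (act : G -> M -> M) (mu : M -> dual R d) : Prop := HamiltonianAction {
  ha_action : smooth_action act;
  ha_symplectic : invariant_tensor act omega;
  ha_smooth : msmooth mu;
  ha_equivariant : forall g p, mu (act g p) = coAd g (mu p);
  ha_momentum : forall (xi : 'rV[R]_d) p v,
    omega p (generated_field act xi p) v = - pairing (mdiff mu p v) xi }.

Definition sub_momentum (R : realType) (d n : nat) (E : normedModType R)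
    (G : lieGroup R d) (N : lieGroup R n) (i : N -> G) (M : charted E)
    (mu : M -> dual R d) : M -> dual R n :=
  fun p => dual_map (lie_map i) (mu p).

Definition regular_value (R : realType) (E E' : normedModType R)
    (M : charted E) (M' : charted E') (f : M -> M') (c : M') : Prop :=
  forall p, f p = c -> forall w, exists v, mdiff f p v = w.

(* [f] is a principal bundle over its image for a left action of [G]: the image
   is open, by [pb_trivial], and [U * G] carries the left translations of [G]. *)
Record principal_bundle (R : realType) (d : nat) (E E' : normedModType R)
    (G : lieGroup R d) (M : charted E) (B : charted E')
    (act : G -> M -> M) (f : M -> B) : Prop := PrincipalBundle {
  pb_action : smooth_action act;
  pb_free : free_action act;
  pb_smooth : msmooth f;
  pb_invariant : forall g p, f (act g p) = f p;
  pb_trivial : forall b, range f b -> exists (U : set B)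
      (t : M -> charted_prod B G) (t' : charted_prod B G -> M),
    [/\ U b,
        diffeo_on (f @^-1` U) (U `*` setT : set (charted_prod B G)) t t',
        (forall p, U (f p) -> (t p).1 = f p) &
        (forall g p, U (f p) -> (t (act g p)).2 = lmul g (t p).2)] }.

(* [j] identifies [Z] with the level set [f @^-1` [set c]] as a submanifold. *)
Definition level_submanifold (R : realType) (E E' F : normedModType R)
    (M : charted E) (M' : charted E') (Z : charted F)
    (f : M -> M') (c : M') (j : Z -> M) : Prop :=
  embedding j /\ range j = f @^-1` [set c].

(* [q] is the projection of the [N]-invariant submanifold [j : Z -> Mt] onto its
   quotient manifold by the action of [N], the image of [i]. *)
Record quotient_manifold (R : realType) (d n : nat) (E F F' : normedModType R)
    (G : lieGroup R d) (N : lieGroup R n) (i : N -> G) (Mt : charted E)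
    (act : G -> Mt -> Mt) (Z : charted F) (j : Z -> Mt) (M : charted F')
    (q : Z -> M) : Prop := QuotientManifold {
  qm_submersion : submersion q;
  qm_surj : range q = setT;
  qm_orbits : forall z z', q z = q z' <-> exists h : N, j z' = act (i h) (j z) }.

(* [h].[z] = [h.z], with [z'] the point of [Z] that is h.z in [Mt]. *)
Definition induced_action (R : realType) (d k : nat) (E F F' : normedModType R)
    (G : lieGroup R d) (K : lieGroup R k) (pi : G -> K) (Mt : charted E)
    (act : G -> Mt -> Mt) (Z : charted F) (j : Z -> Mt) (M : charted F')
    (q : Z -> M) (actK : K -> M -> M) : Prop :=
  forall h z z', j z' = act h (j z) -> actK (pi h) (q z) = q z'.

(* l = u^* + ct, with u the differential of [pi] at the unit. *)
Definition ell (R : realType) (d k : nat) (G : lieGroup R d) (K : lieGroup R k)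
    (pi : G -> K) (ct : dual R d) : dual R k -> dual R d :=
  fun y => (dual_map (lie_map pi) y + ct : 'cV[R]_d).

(* Main.v *)
(* The images of the horizontal lifts through Z = mu_N^-1(c) of nu-horizontal
   vectors of M are mu-horizontal: ker dmu is contained in ker dmu_N = TZ, and q
   maps it into ker dnu because u^* is injective.  Hence ell^* of a reduced
   metric for mu is a reduced metric for nu, and horizontal lifts determine
   reduced metrics.  The bundle nu needs no inverse function theorem: a
   continuous map that becomes smooth after composition with an immersion is
   smooth.  This gives smooth sections of nu, from sections of mu through the
   embedding of Z, and smooth trivialisations, from (y, k) |-> k.S(y), which is
   an immersion by the moment map equation and has a continuous inverse because
   K is compact. *)
Require Import Defs.
From HB Require Import structures.
From mathcomp Require Import all_boot all_order perm all_algebra lra.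
From mathcomp Require Import all_classical all_reals all_analysis.

Set Implicit Arguments.
Unset Strict Implicit.
Unset Printing Implicit Defensive.

Import Order.TTheory GRing.Theory Num.Theory.
Import numFieldNormedType.Exports.

Local Open Scope classical_set_scope.
Local Open Scope ring_scope.

(** * Smooth maps between normed spaces *)

Section Diff.
Variable R : realType.
Implicit Types U V W X : normedModType R.

(** Two obstacles shape the development. Tangent vectors are coordinates in a preferred chart, which
    may jump from point to point, so a pointwise construction of linear algebra has no visible
    regularity: each smoothness claim freezes one chart and shows that the quantity is the same when
    computed there. Moreover, a reduced metric is only described by its values on horizontal lifts,
    which again says nothing about smoothness. It is therefore given by a formula: with [G] the Gram
    matrix of the metric upstairs and [A] the matrix of the differential, the form on the base is
    the inverse of [A^T G^-1 A], and Cramer's rule makes it smooth. Evaluating the formula requires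
    a point in the fibre; invariance under the group makes the result independent of that point, and
    local sections make it smooth in the base point. This construction is carried out for [mu]
    only. *)

Lemma diff_approx V W (f : V -> W) (x : V) : differentiable f x ->
  forall e : R, 0 < e ->
  \forall y \near x, `|f y - f x - 'd f x (y - x)| <= e * `|y - x|.
Proof.
move=> /diff_locally /eqaddoP h e e0.
rewrite [\forall y \near x, _](near_shift 0) subr0.
have := h e e0; apply: filterS => y.
by rewrite !fctE /= addrK opprD addrA.
Qed.

Lemma approx_diff V W (f : V -> W) (x : V) (L : V -> W) :
  linear L -> continuous L ->
  (forall e : R, 0 < e ->
    \forall y \near x, `|f y - f x - L (y - x)| <= e * `|y - x|) ->
  differentiable f x /\ 'd f x = L :> (V -> W).
Proof.
move=> Ll Lc h.
pose dL : {linear V -> W} := HB.pack L (GRing.isLinear.Build _ _ _ _ _ Ll).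
have E : f \o shift x = cst (f x) + dL +o_ 0 id.
  apply/eqaddoP => e e0.
  have := h e e0; rewrite [\forall y \near x, _](near_shift 0) subr0.
  by apply: filterS => y; rewrite !fctE /= addrK opprD addrA.
have dE : 'd f x = L :> (V -> W) by apply: (@diff_unique _ _ _ f dL).
by split => //; apply/diff_locallyP; rewrite dE; split.
Qed.

Lemma near_eq_diff V W (f g : V -> W) (x : V) : (\near x, f x = g x) ->
  differentiable f x -> differentiable g x /\ 'd g x = 'd f x :> (V -> W).
Proof.
move=> fg df; apply: approx_diff.
- exact: linearP.
- exact: diff_continuous.
- move=> e e0; have gx := nbhs_singleton fg.
  have := diff_approx df e0; apply: filterS2 fg => y <-.
  by rewrite gx.
Qed.

Lemma diff_comp_apply U V W (f : U -> V) (g : V -> W) x v :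
  differentiable f x -> differentiable g (f x) ->
  'd (g \o f) x v = 'd g (f x) ('d f x v).
Proof. by move=> df dg; rewrite diff_comp. Qed.

Lemma differentiable_scale V W (f : V -> R^o) (g : V -> W) x :
  differentiable f x -> differentiable g x ->
  differentiable (fun x => f x *: g x) x /\
  forall v, 'd (fun x => f x *: g x) x v = f x *: 'd g x v + 'd f x v *: g x.
Proof.
move=> df dg.
(* The Leibniz rule is that of a continuous bilinear map composed with the pair of [f] and [g]. *)
have bl : bilinear_for (GRing.Scale.Law.clone _ _ *:%R _)
    (GRing.Scale.Law.clone _ _ *:%R _) (fun (a : R^o) (w : W) => a *: w).
  split=> [u'|u] a y z /=.
  - by rewrite scalerDl scalerA.
  - by rewrite scalerDr !scalerA mulrC.
pose b : {bilinear R^o -> W -> W} := HB.pack (fun (a : R^o) (w : W) => a *: w)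
   (bilinear_isBilinear.Build R R^o W W _ _ _ bl).
have bc : continuous (fun p => b p.1 p.2) by exact: scale_continuous.
have dp : differentiable (fun x => (f x, g x)) x by exact: differentiable_pair.
have db : differentiable (fun p => b p.1 p.2) (f x, g x).
  exact: differentiable_bilin.
split.
  rewrite (_ : (fun _ => _) = (fun p => b p.1 p.2) \o (fun x => (f x, g x))) //.
  exact: differentiable_comp.
move=> v.
rewrite (_ : (fun _ => _) = (fun p => b p.1 p.2) \o (fun x => (f x, g x))) //.
by rewrite diff_comp_apply // diff_bilin // diff_pair.
Qed.

Lemma linear_diff V W (f : V -> W) x : linear f -> continuous f ->
  differentiable f x /\ 'd f x = f :> (V -> W).
Proof.
move=> fl fc; apply: approx_diff => // e e0; near=> y.
have fB u v : f (u - v) = f u - f v.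
  by rewrite addrC -scaleN1r fl scaleN1r addrC.
by rewrite fB subrr normr0 mulr_ge0 // ltW.
Unshelve. all: by end_near. Qed.

End Diff.

(** * Calculus of maps of class C^k on open sets *)

Section Ck.
Variable R : realType.
Implicit Types U V W X : normedModType R.

Lemma Ck_onS V W k (A B : set V) (f : V -> W) : A `<=` B ->
  Ck_on k B f -> Ck_on k A f.
Proof.
move=> AB; elim: k f => [|k IH] f /=; first by move=> h x /AB; exact: h.
by move=> [df Cf]; split=> [x /AB|v]; [exact: df|exact/IH/Cf].
Qed.

Lemma eq_Ck_on V W k (A : set V) (f g : V -> W) : open A ->
  (forall x, A x -> f x = g x) -> Ck_on k A f -> Ck_on k A g.
Proof.
move=> oA; elim: k f g => [|k IH] f g fg /=.
  move=> h x Ax.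
  have nfg : \near x, f x = g x by apply: filterS (open_nbhs_nbhs (conj oA Ax)).
  apply: cvg_trans; last (rewrite -(fg _ Ax); exact: h).
  exact: near_eq_cvg.
have nfg x : A x -> \near x, f x = g x.
  by move=> Ax; apply: filterS (open_nbhs_nbhs (conj oA Ax)).
move=> [df Cf]; split=> [x Ax|v].
  by have [] := near_eq_diff (nfg x Ax) (df x Ax).
apply: IH (Cf v) => x Ax.
by have [_ ->] := near_eq_diff (nfg x Ax) (df x Ax).
Qed.

Lemma Ck_on_cont V W k (A : set V) (f : V -> W) : Ck_on k A f ->
  forall x, A x -> {for x, continuous f}.
Proof.
by case: k => // k [df _] x /df; exact: differentiable_continuous.
Qed.

Lemma Ck_on_pred V W k (A : set V) (f : V -> W) : Ck_on k.+1 A f -> Ck_on k A f.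
Proof.
elim: k f => [|k IH] f; first exact: Ck_on_cont.
by move=> [df Cf]; split=> // v; exact: IH.
Qed.

Lemma Ck_on_cst V W k (A : set V) (a : W) : Ck_on k A (cst a : V -> W).
Proof.
elim: k a => [|k IH] a /=; first by move=> x _; exact: cst_continuous.
split=> [x _|v]; first exact: differentiable_cst.
rewrite (_ : (fun _ => _) = cst 0); first exact: IH.
by apply/funext => x; rewrite diff_cst.
Qed.

Lemma Ck_on_linear U V W k (A : set U) (f : U -> V) (L : V -> W) : open A ->
  linear L -> continuous L -> Ck_on k A f -> Ck_on k A (L \o f).
Proof.
move=> oA Ll Lc; elim: k f => [|k IH] f /=.
  by move=> Cf x Ax; apply: continuous_comp; [exact: Cf|exact: Lc].
have dL x := linear_diff x Ll Lc.
move=> [df Cf]; split=> [x Ax|v].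
  by apply: differentiable_comp; [exact: df|have [] := dL (f x)].
apply: eq_Ck_on (IH _ (Cf v)) => // x Ax /=.
have [dLx dE] := dL (f x).
by rewrite (diff_comp_apply v (df x Ax) dLx) dE.
Qed.

Lemma Ck_onD V W k (A : set V) (f g : V -> W) : open A ->
  Ck_on k A f -> Ck_on k A g -> Ck_on k A (f \+ g).
Proof.
move=> oA; elim: k f g => [|k IH] f g /=.
  by move=> Cf Cg x Ax; apply: continuousD; [exact: Cf|exact: Cg].
move=> [df Cf] [dg Cg]; split=> [x Ax|v].
  exact: (differentiableD (df x Ax) (dg x Ax)).
apply: eq_Ck_on (IH _ _ (Cf v) (Cg v)) => // x Ax /=.
exact: (esym (congr1 (fun h : V -> W => h v) (diffD (df x Ax) (dg x Ax)))).
Qed.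

Lemma Ck_onZ V W k (A : set V) (f : V -> R^o) (g : V -> W) : open A ->
  Ck_on k A f -> Ck_on k A g -> Ck_on k A (fun x => f x *: g x).
Proof.
move=> oA; elim: k f g => [|k IH] f g.
  by move=> /= Cf Cg x Ax; apply: continuousZ; [exact: Cf|exact: Cg].
move=> CCf CCg; have Cf0 := Ck_on_pred CCf; have Cg0 := Ck_on_pred CCg.
move: CCf CCg => [df Cf] [dg Cg]; split=> [x Ax|v].
  by have [] := differentiable_scale (df x Ax) (dg x Ax).
apply: eq_Ck_on (Ck_onD oA (IH _ _ Cf0 (Cg v)) (IH _ _ (Cf v) Cg0)) => //.
by move=> x Ax /=; have [_ ->] := differentiable_scale (df x Ax) (dg x Ax).
Qed.

Lemma Ck_on_sum V W k (A : set V) (I : Type) (r : seq I) (P : pred I)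
    (f : I -> V -> W) : open A ->
  (forall i, Ck_on k A (f i)) -> Ck_on k A (fun x => \sum_(i <- r | P i) f i x).
Proof.
move=> oA Cf; elim: r => [|i r IH].
  apply: eq_Ck_on (Ck_on_cst k A (0 : W)) => // x _; by rewrite big_nil.
have [Pi|nPi] := boolP (P i); last first.
  by apply: eq_Ck_on IH => // x _; rewrite big_cons (negbTE nPi).
apply: eq_Ck_on (Ck_onD oA (Cf i) IH) => // x _.
by rewrite big_cons Pi.
Qed.

Lemma Ck_onV V k (A : set V) (f : V -> R^o) : open A ->
  (forall x, A x -> f x != 0) -> Ck_on k A f -> Ck_on k A (fun x => (f x)^-1 : R^o).
Proof.
move=> oA f0; elim: k => [|k IH].
  by move=> /= Cf x Ax; apply: continuousV; [exact: f0|exact: Cf].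
move=> CCf; have /IH Ci := Ck_on_pred CCf.
move: CCf => [df Cf]; split=> [x Ax|v].
  exact: (@differentiableV R V f x (df x Ax) (f0 x Ax)).
(* The derivative of [f^-1] is [- f^-2 'd f], again built from [f^-1], which is C^k by induction. *)
have Cm := Ck_onZ oA (Ck_on_cst k A (-1 : R^o)) (Ck_onZ oA Ci Ci).
apply: eq_Ck_on (Ck_onZ oA Cm (Cf v)) => // x Ax.
have e := congr1 (fun h : V -> R => h v) (@diffV _ _ f x (df x Ax) (f0 x Ax)).
apply: etrans _ (esym e).
by rewrite /= /GRing.scale /= mulN1r -invfM expr2.
Qed.

(** A basis together with its dual coordinates, whose continuity is part of the data; row vectors,
    column vectors and products are covered uniformly. *)
Definition findim V := exists n (e : 'I_n -> V) (c : 'I_n -> {linear V -> R^o}),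
  [/\ forall i, continuous (c i), forall i j, c i (e j) = (i == j)%:R &
      forall x, x = \sum_i c i x *: e i].

(** The derivative ['d g (f x) ('d f x v)] varies in base point and direction at once, while the
    induction hypothesis handles fixed directions only. Expanding ['d f x v] in a basis of [V] gives
    a sum of scalar functions times ['d g (f x) (e i)]; this is where finite dimension enters. *)
Lemma Ck_on_comp U V W k (A : set U) (B : set V) (f : U -> V) (g : V -> W) :
  findim V -> open A -> (forall x, A x -> B (f x)) ->
  Ck_on k A f -> Ck_on k B g -> Ck_on k A (g \o f).
Proof.
move=> [n [e [c [cc ce cE]]]] oA fAB; elim: k f g fAB => [|k IH] f g fAB.
  move=> /= Cf Cg x Ax; apply: continuous_comp; first exact: Cf.
  exact/Cg/fAB.
move=> CCf [dg Cg]; have Cf0 := Ck_on_pred CCf; move: CCf => [df Cf].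
split=> [x Ax|v].
  by apply: differentiable_comp; [exact: df|exact/dg/fAB].
have CS : Ck_on k A (fun x => \sum_i c i ('d f x v) *: 'd g (f x) (e i)).
  apply: Ck_on_sum => // i; apply: Ck_onZ => //.
    apply: (Ck_on_linear oA _ (cc i) (Cf v)); exact: linearP.
  exact: (IH f (fun y => 'd g y (e i)) fAB Cf0 (Cg (e i))).
apply: eq_Ck_on CS => // x Ax.
rewrite (diff_comp_apply v (df x Ax) (dg _ (fAB x Ax))).
rewrite [in RHS](cE ('d f x v)) linear_sum; apply: eq_bigr => i _.
by rewrite linearZ.
Qed.

End Ck.

(** * Smoothness of germs and of matrix-valued functions *)

Section SmoothNear.
Variable R : realType.
Implicit Types U V W X : normedModType R.

Lemma near_open (T : topologicalType) (x : T) (P : set T) :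
  (\forall y \near x, P y) -> exists2 B : set T, open_nbhs x B & B `<=` P.
Proof. by move=> h; have : nbhs x P by []; rewrite nbhsE. Qed.

(** One neighbourhood serves all orders of differentiability, so closure properties reduce to those
    of [Ck_on] after intersecting neighbourhoods. *)
Definition smooth_near V W (f : V -> W) (x : V) :=
  exists2 A : set V, open_nbhs x A & smooth_on A f.

Lemma Ck_on_local V W k (A : set V) (f : V -> W) :
  (forall x, A x -> exists2 B : set V, open_nbhs x B & Ck_on k B f) ->
  Ck_on k A f.
Proof.
elim: k f => [|k IH] f /= h.
  by move=> x /h[B [_ Bx]]; apply.
split=> [x /h[B [_ Bx]] [+ _]|v]; first exact.
by apply: IH => x /h[B oB [_ Cf]]; exists B.
Qed.

Lemma smooth_onP V W (A : set V) (f : V -> W) : open A ->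
  smooth_on A f <-> forall x, A x -> smooth_near f x.
Proof.
move=> oA; split=> [Cf x Ax|h k]; first by exists A.
by apply: Ck_on_local => x /h[B oB Cf]; exists B.
Qed.

Lemma near_eq_smooth V W (f g : V -> W) x : (\near x, f x = g x) ->
  smooth_near f x -> smooth_near g x.
Proof.
move=> /near_open[B [oB Bx] fg] [A [oA Ax] Cf].
exists (A `&` B); first by split; [exact: openI|split].
move=> k; apply: (@eq_Ck_on _ _ _ _ _ f); first exact: openI.
  by move=> y [_ /fg].
by apply: Ck_onS (Cf k) => y [].
Qed.

Lemma smooth_near_near V W (f : V -> W) x : smooth_near f x ->
  \forall y \near x, smooth_near f y.
Proof.
move=> [A [oA Ax] Cf]; have nA : nbhs x A by apply: open_nbhs_nbhs.
apply: filterS nA => y Ay.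
by exists A.
Qed.

Lemma smooth_near_differentiable V W (f : V -> W) x : smooth_near f x ->
  differentiable f x.
Proof. by move=> [A [_ Ax] /(_ 1%N)[df _]]; exact: df. Qed.

Lemma smooth_near_cont V W (f : V -> W) x : smooth_near f x ->
  {for x, continuous f}.
Proof. by move/smooth_near_differentiable/differentiable_continuous. Qed.

Lemma smooth_near_diff V W (f : V -> W) x v : smooth_near f x ->
  smooth_near (fun y => 'd f y v) x.
Proof. by move=> [A oA Cf]; exists A => // k; have [_ h] := Cf k.+1; exact: h. Qed.

Lemma smooth_near_cst V W (a : W) (x : V) : smooth_near (cst a) x.
Proof.
exists setT; first by split=> //; exact: openT.
by move=> k; exact: Ck_on_cst.
Qed.

Lemma smooth_near_linear_comp U V W (f : U -> V) (L : V -> W) x :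
  linear L -> continuous L -> smooth_near f x -> smooth_near (L \o f) x.
Proof.
move=> Ll Lc [A [oA Ax] Cf]; exists A => // k.
exact: Ck_on_linear.
Qed.

Lemma smooth_near_comp U V W (f : U -> V) (g : V -> W) x : findim V ->
  smooth_near f x -> smooth_near g (f x) -> smooth_near (g \o f) x.
Proof.
move=> fV Cf [B oB Cg]; have cf := smooth_near_cont Cf.
have /near_open[A' [oA' A'x] fA'] := cf _ (open_nbhs_nbhs oB).
case: Cf => A [oA Ax] Cf.
exists (A `&` A'); first by split; [exact: openI|].
move=> k; apply: (@Ck_on_comp _ _ _ _ _ _ B) => //; first exact: openI.
  by move=> y [_ /fA'].
by apply: Ck_onS (Cf k) => y [].
Qed.

Lemma smooth_near2 V W X (Y : normedModType R) (f : V -> W) (g : V -> X) (h : V -> Y) x :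
  (forall A, open A -> smooth_on A f -> smooth_on A g -> smooth_on A h) ->
  smooth_near f x -> smooth_near g x -> smooth_near h x.
Proof.
move=> H [A [oA Ax] Cf] [B [oB Bx] Cg].
exists (A `&` B); first by split; [exact: openI|].
apply: H; first exact: openI.
- by move=> k; apply: Ck_onS (Cf k) => y [].
- by move=> k; apply: Ck_onS (Cg k) => y [].
Qed.

Lemma smooth_nearD V W (f g : V -> W) x :
  smooth_near f x -> smooth_near g x -> smooth_near (f \+ g) x.
Proof. by apply: smooth_near2 => A oA Cf Cg k; exact: Ck_onD. Qed.

Lemma smooth_nearZ V W (f : V -> R^o) (g : V -> W) x :
  smooth_near f x -> smooth_near g x -> smooth_near (fun x => f x *: g x) x.
Proof. by apply: smooth_near2 => A oA Cf Cg k; exact: Ck_onZ. Qed.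

Lemma smooth_near_sum V W (I : Type) (r : seq I) (P : pred I)
    (f : I -> V -> W) x : (forall i, smooth_near (f i) x) ->
  smooth_near (fun x => \sum_(i <- r | P i) f i x) x.
Proof.
move=> Cf; elim: r => [|i r IH].
  rewrite (_ : (fun _ => _) = cst 0); first exact: smooth_near_cst.
  by apply/funext => y; rewrite big_nil.
rewrite (_ : (fun _ => _) = if P i then
    f i \+ (fun x => \sum_(i <- r | P i) f i x)
    else (fun x => \sum_(i <- r | P i) f i x)).
  by case: ifP => // _; exact: smooth_nearD.
by apply/funext => y; rewrite big_cons; case: ifP.
Qed.

Lemma smooth_near_prod V (I : Type) (r : seq I) (P : pred I)
    (f : I -> V -> R^o) x : (forall i, smooth_near (f i) x) ->
  smooth_near (fun x => \prod_(i <- r | P i) f i x : R^o) x.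
Proof.
move=> Cf; elim: r => [|i r IH].
  rewrite (_ : (fun _ => _) = cst (1 : R^o)); first exact: smooth_near_cst.
  by apply/funext => y; rewrite big_nil.
rewrite (_ : (fun _ => _) = if P i then
    (fun x => f i x *: (\prod_(i <- r | P i) f i x : R^o))
    else (fun x => \prod_(i <- r | P i) f i x : R^o)).
  by case: ifP => // _; exact: smooth_nearZ.
by apply/funext => y; rewrite big_cons; case: ifP.
Qed.

Lemma smooth_near_neq0 V (f : V -> R^o) x : smooth_near f x -> f x != 0 ->
  \forall y \near x, f y != 0.
Proof.
move=> /smooth_near_cont cf f0.
have : nbhs (f x) [set y | y != 0] by apply: open_nbhs_nbhs; split => //; exact: open_neq.
exact: cf.
Qed.

Lemma smooth_nearV V (f : V -> R^o) x : f x != 0 ->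
  smooth_near f x -> smooth_near (fun x => (f x)^-1 : R^o) x.
Proof.
move=> f0 Cf; have /near_open[B [oB Bx] fB] := smooth_near_neq0 Cf f0.
case: Cf => A [oA Ax] Cf.
exists (A `&` B); first by split; [exact: openI|].
move=> k; apply: Ck_onV; first exact: openI.
  by move=> y [_ /fB].
by apply: Ck_onS (Cf k) => y [].
Qed.

Lemma linear_smooth V W (L : V -> W) x :
  linear L -> continuous L -> smooth_near L x.
Proof.
move=> Ll Lc; exists setT; first by split=> //; exact: openT.
move=> k; apply: (@eq_Ck_on _ _ _ _ _ (L \o id)) => //; first exact: openT.
apply: Ck_on_linear => //; first exact: openT.
elim: k => [|[|k] IH] /=; first by move=> ? _; exact: cvg_id.
  split=> [? _|v ? _]; first by apply: ex_diff.
  by rewrite (_ : (fun _ => _) = cst v);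
    [exact: cst_continuous|apply/funext => y; rewrite diff_val].
split=> [? _|v]; first by apply: ex_diff.
rewrite (_ : (fun _ => _) = cst v); first exact: (Ck_on_cst k.+1).
by apply/funext => y; rewrite diff_val.
Qed.

Lemma smooth_near_id V (x : V) : smooth_near id x.
Proof. by apply: linear_smooth => // ?; exact: cvg_id. Qed.

Lemma smooth_near_pair U V W (f : U -> V) (g : U -> W) x :
  smooth_near f x -> smooth_near g x -> smooth_near (fun x => (f x, g x)) x.
Proof.
move=> Cf Cg.
have Lf : smooth_near ((fun v : V => (v, 0 : W)) \o f) x.
  apply: smooth_near_linear_comp => //.
    by move=> a u v; congr (_, _); rewrite /= scaler0 addr0.
  by move=> y; apply: cvg_pair; [exact: cvg_id|exact: cvg_cst].
have Lg : smooth_near ((fun w : W => (0 : V, w)) \o g) x.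
  apply: smooth_near_linear_comp => //.
    by move=> a u v; congr (_, _); rewrite /= scaler0 addr0.
  by move=> y; apply: cvg_pair; [exact: cvg_cst|exact: cvg_id].
apply: near_eq_smooth (smooth_nearD Lf Lg); apply: nearW => y.
by congr (_, _); rewrite /= ?addr0 ?add0r.
Qed.

Lemma coord_linear m n (i : 'I_m) (j : 'I_n) :
  linear (fun A : 'M[R]_(m, n) => A i j : R^o).
Proof. by move=> a u v; rewrite !mxE. Qed.

Definition linear_of V W (f : V -> W) (fl : linear f) : {linear V -> W} :=
  HB.pack f (GRing.isLinear.Build _ _ _ _ _ fl).

Lemma findim_rV n : findim 'rV[R]_n.
Proof.
exists n, (delta_mx 0), (fun i => linear_of (@coord_linear 1 n 0 i)); split => /=.
- by move=> i; exact: coord_continuous.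
- by move=> i j; rewrite mxE eqxx /=.
- exact: row_sum_delta.
Qed.

Lemma findim_cV n : findim 'cV[R]_n.
Proof.
exists n, (delta_mx^~ 0), (fun i => linear_of (@coord_linear n 1 i 0)); split => /=.
- by move=> i; exact: coord_continuous.
- by move=> i j; rewrite mxE eqxx andbT.
- move=> x; apply/colP => i; rewrite summxE (bigD1 i) //= big1 ?addr0.
    by rewrite !mxE !eqxx mulr1.
  by move=> j /negbTE ji; rewrite !mxE eq_sym ji mulr0.
Qed.

Lemma findim_prod V W : findim V -> findim W -> findim (V * W)%type.
Proof.
move=> [m [e [c [cc ce cE]]]] [n [e' [c' [cc' ce' cE']]]].
pose ee (k : 'I_(m + n)) : (V * W)%type :=
  match fintype.split k with inl i => (e i, 0) | inr j => (0, e' j) end.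
pose cf (k : 'I_(m + n)) (x : (V * W)%type) : R^o :=
  match fintype.split k with inl i => c i x.1 | inr j => c' j x.2 end.
have cl k : linear (cf k).
  by move=> a u v; rewrite /cf; case: fintype.split => i; rewrite linearP.
exists (m + n)%N, ee, (fun k => linear_of (cl k)); split => /=.
- move=> k x; rewrite /cf; case: fintype.split => i.
    by apply: cvg_comp; [exact: cvg_fst|exact: cc].
  by apply: cvg_comp; [exact: cvg_snd|exact: cc'].
- move=> i j; rewrite /cf /ee -[in RHS](splitK i) -[in RHS](splitK j).
  by case: (fintype.split i) => i'; case: (fintype.split j) => j' /=;
    rewrite ?linear0 ?ce ?ce' ?eq_lshift ?eq_rshift ?eq_lrshift ?eq_rlshift.
- move=> [x y]; rewrite big_split_ord /= /cf /ee.
  under eq_bigr do rewrite (unsplitK (inl _)).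
  under [X in _ = _ + X]eq_bigr do rewrite (unsplitK (inr _)).
  transitivity ((x, 0) + (0, y) : V * W).
    by congr (_, _); rewrite /= ?addr0 ?add0r.
  congr (_ + _).
    rewrite [in LHS](cE x) (big_morph (fun x : V => (x, 0 : W)) (id1 := 0) (op1 := +%R)) //.
      by apply: eq_bigr => i _; congr (_, _); rewrite /= scaler0.
    by move=> a b; congr (_, _); rewrite /= addr0.
  rewrite [in LHS](cE' y) (big_morph (fun y : W => (0 : V, y)) (id1 := 0) (op1 := +%R)) //.
    by apply: eq_bigr => i _; congr (_, _); rewrite /= scaler0.
  by move=> a b; congr (_, _); rewrite /= addr0.
Qed.

(** Entrywise, because products, determinants and cofactors are polynomial in the entries. *)
Definition smooth_mx V m n (f : V -> 'M[R]_(m, n)) x :=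
  forall i j, smooth_near (fun x => f x i j : R^o) x.

Lemma smooth_det V n (f : V -> 'M[R]_n) x : smooth_mx f x ->
  smooth_near (fun x => \det (f x) : R^o) x.
Proof.
move=> Cf; apply: smooth_near_sum => s.
have Cp : smooth_near (fun y => \prod_i f y i (s i) : R^o) x.
  exact: smooth_near_prod.
exact: (smooth_nearZ (smooth_near_cst ((-1) ^+ s : R^o) x) Cp).
Qed.

Lemma smooth_mulmx V m n p (f : V -> 'M[R]_(m, n)) (g : V -> 'M[R]_(n, p)) x :
  smooth_mx f x -> smooth_mx g x -> smooth_mx (fun x => f x *m g x) x.
Proof.
move=> Cf Cg i j.
apply: near_eq_smooth (@smooth_near_sum _ _ _ (index_enum 'I_n) xpredT
  (fun k x => f x i k *: (g x k j : R^o)) _ _) => [|k].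
  by apply: nearW => y; rewrite mxE.
exact: smooth_nearZ.
Qed.

Lemma smooth_trmx V m n (f : V -> 'M[R]_(m, n)) x :
  smooth_mx f x -> smooth_mx (fun x => (f x)^T) x.
Proof.
move=> Cf i j; apply: near_eq_smooth (Cf j i).
by apply: nearW => y; rewrite mxE.
Qed.

Lemma smooth_cst_mx V m n (A : 'M[R]_(m, n)) (x : V) : smooth_mx (fun=> A) x.
Proof. by move=> i j; exact: smooth_near_cst. Qed.

Lemma smooth_mx_unit V n (f : V -> 'M[R]_n) x : smooth_mx f x ->
  f x \in unitmx -> \forall y \near x, f y \in unitmx.
Proof.
move=> /smooth_det Cf; rewrite unitmxE unitfE => /(smooth_near_neq0 Cf).
by apply: filterS => y; rewrite unitmxE unitfE.
Qed.

(** Cramer's rule. As [invmx] returns its argument on singular matrices, the cofactor formula is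
    used only near [x], where the determinant stays nonzero. *)
Lemma smooth_invmx V n (f : V -> 'M[R]_n) x : smooth_mx f x ->
  f x \in unitmx -> smooth_mx (fun x => invmx (f x)) x.
Proof.
move=> Cf ux i j.
have near_u := smooth_mx_unit Cf ux.
apply: (@near_eq_smooth _ _ (fun x => (\det (f x))^-1 *:
   (((-1) ^+ (j + i) : R^o) *: (\det (row' j (col' i (f x))) : R^o)))).
  by near=> y; rewrite /invmx (near near_u y) // !mxE.
apply: smooth_nearZ.
  apply: (@smooth_nearV _ (fun x => \det (f x))); last exact: smooth_det.
  by rewrite -unitfE -unitmxE.
apply: (@smooth_nearZ _ _ (fun=> (-1) ^+ (j + i) : R^o)); first exact: smooth_near_cst.
apply: smooth_det => k l; apply: near_eq_smooth (Cf (lift j k) (lift i l)).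
by apply: nearW => y; rewrite !mxE.
Unshelve. all: by end_near. Qed.

End SmoothNear.

(** * Regularity of continuous lifts through immersions *)

Section Lift.
Variable R : realType.
Implicit Types U V W : normedModType R.

(** Let [r1] be the remainder of [F] along [s] and [r2] that of [F \o s]. Applying the left inverse
    [L] gives [s y - s x - D (y - x) = L r2 - L r1]. Here [r1] is small only relative to
    [|s y - s x|], and [s] is merely continuous: the term is first absorbed to obtain a Lipschitz
    bound for [s] at [x], which then turns it into an error relative to [|y - x|]. *)
Lemma diff_lift U V W (F : V -> W) (s : U -> V) (L : W -> V) x :
  linear L -> continuous L -> (forall v, L ('d F (s x) v) = v) ->
  {for x, continuous s} -> differentiable F (s x) ->
  differentiable (F \o s) x ->
  differentiable s x /\ 'd s x = L \o 'd (F \o s) x :> (U -> V).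
Proof.
move=> Ll Lc LK cs dF dFs.
set D : U -> V := L \o 'd (F \o s) x.
have Dl : linear D by move=> a u v; rewrite /D /= linearP Ll.
have Dc : continuous D.
  by move=> y; apply: continuous_comp; [exact: diff_continuous|exact: Lc].
have [C C0 LC] := linear_lipschitz (f := linear_of Ll) Lc.
have [K K0 DK] := linear_lipschitz (f := linear_of Dl) Dc.
apply: approx_diff => // e e0.
(* With [C] and [K] bounding [L] and [D], the two errors become [a |s y - s x|] and [e / 2 |y - x|],
   where [a = e / (4K + 4e)]. As [a <= 1/4], absorption yields [|s y - s x| <= (2K + e) |y - x|],
   and [a (2K + e) <= e / 2] closes the estimate. *)
pose e1 := e / (4 * K + 4 * e) / C; pose e2 := e / 2 / C.
have Ke0 : 0 < 4 * K + 4 * e by rewrite addr_gt0 ?mulr_gt0.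
have e10 : 0 < e1 by rewrite !divr_gt0.
have e20 : 0 < e2 by rewrite !divr_gt0.
have h1 := cs _ (diff_approx dF e10).
have h2 := diff_approx dFs e20.
near=> y.
have g1 : `|F (s y) - F (s x) - 'd F (s x) (s y - s x)| <= e1 * `|s y - s x|.
  by near: y; exact: h1.
have g2 : `|F (s y) - F (s x) - 'd (F \o s) x (y - x)| <= e2 * `|y - x|.
  by near: y; exact: h2.
set r1 := (X in `|X| <= _) in g1; set r2 := (X in `|X| <= _) in g2.
have LB u v : L (u - v) = L u - L v by exact: (linearB (linear_of Ll)).
have E : s y - s x - D (y - x) = L r2 - L r1.
  rewrite /r1 /r2 LB [L (_ - 'd F _ _)]LB LK opprB.
  by rewrite [RHS]addrC addrA subrK.
have ub : `|s y - s x - D (y - x)| <= C * e2 * `|y - x| + C * e1 * `|s y - s x|.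
  rewrite E; apply: le_trans (ler_normB _ _) _; apply: lerD.
    by apply: le_trans (LC r2) _; rewrite -mulrA ler_pM2l.
  by apply: le_trans (LC r1) _; rewrite -mulrA ler_pM2l.
have Ce2 : C * e2 = e / 2 by rewrite /e2 mulrC divfK // gt_eqF.
have Ce1 : C * e1 = e / (4 * K + 4 * e) by rewrite /e1 mulrC divfK // gt_eqF.
rewrite Ce1 Ce2 in ub.
have Dh : `|D (y - x)| <= K * `|y - x| by exact: DK.
have tri : `|s y - s x| <= `|s y - s x - D (y - x)| + `|D (y - x)|.
  by apply: le_trans (ler_normD _ _); rewrite subrK.
move: ub Dh tri; set N := `|s y - s x - _|; set H := `|y - x|.
set S := `|s y - s x|; set M := `|D _|; set a := e / (4 * K + _) => ub Dh tri.
have aE : a * (4 * K + 4 * e) = e by rewrite /a divfK // gt_eqF.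
have a0 : 0 < a by rewrite /a divr_gt0.
have a4 : a <= 1 / 4.
  rewrite /a ler_pdivrMr //; rewrite mulrDr; rewrite !mulrA div1r mulVf // !mul1r.
  by rewrite lerDr ltW.
have H0 : 0 <= H by exact: normr_ge0.
have S0 : 0 <= S by exact: normr_ge0.
have N0 : 0 <= N by exact: normr_ge0.
have S1 : S <= (2 * K + e) * H by nra.
have S2 : a * S <= a * ((2 * K + e) * H) by rewrite ler_pM2l.
nra.
Unshelve. all: by end_near. Qed.

(* With [L] a smooth family of left inverses of the differentials of [F], the
   formula ['d s = L \o 'd (F \o s)] bootstraps the regularity of [s]. *)
Lemma smooth_lift U V W (F : V -> W) (s : U -> V) x :
  findim V -> findim W ->
  (\forall y \near x, {for y, continuous s}) ->
  smooth_near F (s x) -> smooth_near (F \o s) x ->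
  injective ('d F (s x)) -> smooth_near s x.
Proof.
move=> fV [p [e' [c' [cc' ce' cE']]]] cs CF CFs inj.
have [n [e [c [cc ce cE]]]] := fV.
pose A y := \matrix_(i < n, j < p) (c' j ('d F y (e i)) : R).
have A_smooth y : smooth_near F y -> smooth_mx A y.
  move=> Cy i j.
  apply: near_eq_smooth (smooth_near_linear_comp _ (cc' j)
    (smooth_near_diff (e i) Cy)); last exact: linearP.
  by apply: nearW => z; rewrite !mxE.
have cA y v : \row_j (c' j ('d F y v) : R) = (\row_i (c i v : R)) *m A y.
  apply/rowP => j; rewrite !mxE {1}[v]cE !linear_sum.
  by apply: eq_bigr => i _; rewrite !linearZ !mxE.
have A_free : row_free (A (s x)).
  apply: inj_row_free => v vA.
  have cv i : c i (\sum_i v 0 i *: e i) = v 0 i.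
    rewrite linear_sum (bigD1 i) //= big1 ?addr0.
      by rewrite linearZ /= ce eqxx /GRing.scale /= mulr1.
    by move=> k /negbTE ki; rewrite linearZ /= ce eq_sym ki /GRing.scale /= mulr0.
  have E : \row_i (c i (\sum_i v 0 i *: e i) : R) = v.
    by apply/rowP => i; rewrite mxE cv.
  have dF0 : 'd F (s x) (\sum_i v 0 i *: e i) = 0.
    rewrite (cE' ('d F (s x) _)) big1 // => j _.
    have := cA (s x) (\sum_i v 0 i *: e i).
    by rewrite E vA => /rowP/(_ j); rewrite !mxE => ->; rewrite scale0r.
  have v0 : \sum_i v 0 i *: e i = 0 by apply: inj; rewrite dF0 linear0.
  by rewrite -E; apply/rowP => i; rewrite !mxE v0 linear0.
(* [P] is a right inverse of [A (s x)] and stays fixed: [A y *m P] is the identity at [y = s x],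
   hence invertible nearby, and multiplication by [P] and then by the inverse [B y] is a left
   inverse of the differential of [F] at [y], smooth in [y]. *)
pose P := pinvmx (A (s x)).
pose B y := invmx (A y *m P).
have AP : A (s x) *m P \in unitmx by rewrite mulmxVp ?unitmx1.
have AP_smooth y : smooth_near F y -> smooth_mx (fun y => A y *m P) y.
  move=> Cy; apply: smooth_mulmx; [exact: A_smooth|exact: smooth_cst_mx].
pose L y w := \sum_i (((\row_j (c' j w : R)) *m P *m B y) 0 i : R) *: e i.
have Ll y : linear (L y).
  move=> a u v; rewrite /L scaler_sumr -big_split /=; apply: eq_bigr => i _.
  rewrite scalerA -scalerDl; congr (_ *: _).
  rewrite (_ : \row_j _ = a *: (\row_j (c' j u : R)) + \row_j (c' j v : R)).
    by rewrite !mulmxDl -!scalemxAl !mxE.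
  by apply/rowP => j; rewrite !mxE linearP.
have Lc y : continuous (L y).
  move=> w; apply: smooth_near_cont.
  apply: smooth_near_sum => i; apply: smooth_nearZ; last exact: smooth_near_cst.
  apply: smooth_mulmx; last exact: smooth_cst_mx.
  apply: smooth_mulmx; last exact: smooth_cst_mx.
  move=> k j; apply: near_eq_smooth (linear_smooth w _ (cc' j)); last exact: linearP.
  by apply: nearW => z; rewrite !mxE.
have LdF y v : A y *m P \in unitmx -> L y ('d F y v) = v.
  move=> uy; rewrite [in RHS](cE v); apply: eq_bigr => i _.
  by rewrite cA -(mulmxA _ (A y)) mulmxK // mxE.
have /near_open[N [oN Nx] Nh] : \forall y \near x, [/\ {for y, continuous s},
    smooth_near F (s y), smooth_near (F \o s) y & A (s y) *m P \in unitmx].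
  have csx := nbhs_singleton cs.
  have nF := csx _ (smooth_near_near CF).
  have nA := csx _ (smooth_mx_unit (AP_smooth _ CF) AP).
  have nFs := smooth_near_near CFs.
  near=> y; split; by near: y.
have dsE y : N y -> differentiable s y /\
    forall v, 'd s y v = L (s y) ('d (F \o s) y v).
  move=> /Nh[csy CFy CFsy uy].
  have [ds dsE] := diff_lift (Ll (s y)) (Lc (s y)) (fun v => LdF _ v uy) csy
    (smooth_near_differentiable CFy) (smooth_near_differentiable CFsy).
  by split=> // v; rewrite dsE.
exists N => //; elim=> [|k IH]; first by move=> y /Nh[].
split=> [y /dsE[]//|v].
pose g j y := ((\row_l (c' l ('d (F \o s) y v) : R)) *m P) 0 j : R^o.
have Cg j : Ck_on k N (g j).
  suff : smooth_on N (g j) by apply.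
  apply/smooth_onP => // y /Nh[_ _ CFsy _].
  apply: smooth_mulmx; last exact: smooth_cst_mx.
  move=> i l; apply: near_eq_smooth (smooth_near_linear_comp _ (cc' l)
    (smooth_near_diff v CFsy)); last exact: linearP.
  by apply: nearW => z; rewrite !mxE.
(* The only factor that involves [s] itself; the induction hypothesis that [s] is C^k enters
   here. *)
have CB j i : Ck_on k N (fun y => B (s y) j i : R^o).
  pose D := [set z | smooth_mx B z].
  apply: (@Ck_on_comp _ _ _ _ k N D s (fun z => B z j i : R^o)) => //.
    move=> y /Nh[_ CFy _ uy]; apply: smooth_invmx => //; exact: AP_smooth.
  by apply: Ck_on_local => z /(_ j i)[N' oN' CN]; exists N'.
have CS : Ck_on k N (fun y => \sum_i (\sum_j g j y *: (B (s y) j i : R^o)) *: e i).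
  apply: Ck_on_sum => // i; apply: Ck_onZ => //; last exact: Ck_on_cst.
  by apply: Ck_on_sum => // j; exact: Ck_onZ.
apply: eq_Ck_on CS => // y /dsE[_ ->].
by apply: eq_bigr => i _; rewrite [in RHS]mxE.
Unshelve. all: by end_near. Qed.

End Lift.

(** * Smooth maps between manifolds *)

Section Manifolds.
Variable R : realType.
Implicit Types E : normedModType R.

(* What is needed of [manifold], in a form that also covers [charted_vec] and
   [charted_prod]. *)
Record smooth_atlas E (M : charted E) : Prop := SmoothAtlas {
  sm_findim : findim E;
  sm_chart : forall c, atlas M c -> is_chart c;
  sm_compat : forall c c', atlas M c -> atlas M c' ->
    smooth_on (cmap c @` (cdom c `&` cdom c')) (cmap c' \o cinv c);
  sm_chart_at : forall p : M, atlas M (chart_at p) /\ cdom (chart_at p) p }.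

Lemma manifold_atlas n (M : manifold R n) : smooth_atlas M.
Proof.
split; [exact: findim_rV|exact: mchart|exact: mcompat|exact: mchart_at].
Qed.

Lemma vec_atlas E : findim E -> smooth_atlas (charted_vec E).
Proof.
move=> fE; split => //.
- move=> c ->; split => //=.
  + exact: openT.
  + by rewrite image_id; exact: openT.
  + by move=> p _; exact: cvg_id.
  + by move=> p _; exact: cvg_id.
- move=> c c' -> ->; apply/smooth_onP => [|x _]; last exact: smooth_near_id.
  by rewrite /= image_id; apply: openI; exact: openT.
Qed.

Section ChartFacts.
Variables (E : normedModType R) (M : charted E) (MA : smooth_atlas M).
Variables (c : chart E M) (p : M) (ac : atlas M c) (cp : cdom c p).

Lemma near_cdom : \forall q \near p, cdom c q.
Proof. by apply: open_nbhs_nbhs; split => //; exact: cdom_open (sm_chart MA ac). Qed.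

Lemma near_cimg : \forall x \near cmap c p, (cmap c @` cdom c) x.
Proof.
apply: open_nbhs_nbhs; split; first exact: cimg_open (sm_chart MA ac).
by exists p.
Qed.

Lemma cinvK x : (cmap c @` cdom c) x -> cmap c (cinv c x) = x.
Proof. by move=> [q dq <-]; rewrite (cmapK (sm_chart MA ac)). Qed.

Lemma cinv_dom x : (cmap c @` cdom c) x -> cdom c (cinv c x).
Proof. by move=> [q dq <-]; rewrite (cmapK (sm_chart MA ac)). Qed.

Lemma near_cinv (P : set M) : (\forall q \near p, P q) ->
  \forall x \near cmap c p, P (cinv c x).
Proof.
move=> nP; have ic : (cmap c @` cdom c) (cmap c p) by exists p.
have h := cinv_cont (sm_chart MA ac) ic.
by apply: h; rewrite (cmapK (sm_chart MA ac)).
Qed.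

End ChartFacts.

Lemma open_cimg E (M : charted E) (MA : smooth_atlas M) (c : chart E M) (A : set M) :
  atlas M c -> open A -> A `<=` cdom c -> open (cmap c @` A).
Proof.
move=> ac oA AD; rewrite openE => _ [p Ap <-].
have cp := AD _ Ap.
have nA : \forall q \near p, A q by apply: open_nbhs_nbhs.
have n1 := near_cinv MA ac cp nA.
have n2 := near_cimg MA ac cp.
rewrite /interior; near=> x.
have Acx : A (cinv c x) by near: x.
have ix : (cmap c @` cdom c) x by near: x.
by exists (cinv c x) => //; exact: (cinvK MA ac ix).
Unshelve. all: by end_near. Qed.

Lemma smooth_transition E (M : charted E) (MA : smooth_atlas M) (c c' : chart E M) p :
  atlas M c -> atlas M c' -> cdom c p -> cdom c' p ->
  smooth_near (cmap c' \o cinv c) (cmap c p).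
Proof.
move=> ac ac' cp c'p; have Cf := sm_compat MA ac ac'.
exists (cmap c @` (cdom c `&` cdom c')) => //.
split; last by exists p.
apply: (open_cimg MA ac); last by move=> ? [].
by apply: openI; [exact: cdom_open (sm_chart MA ac)|exact: cdom_open (sm_chart MA ac')].
Qed.

Lemma smooth_chart_change E E' (M : charted E) (M' : charted E')
    (MA : smooth_atlas M) (MA' : smooth_atlas M') (f : M -> M') p
    (c1 c2 : chart E M) (d1 d2 : chart E' M') :
  atlas M c1 -> atlas M c2 -> atlas M' d1 -> atlas M' d2 ->
  cdom c1 p -> cdom c2 p -> cdom d1 (f p) -> cdom d2 (f p) ->
  {for p, continuous f} ->
  smooth_near (cmap d1 \o f \o cinv c1) (cmap c1 p) ->
  smooth_near (cmap d2 \o f \o cinv c2) (cmap c2 p).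
Proof.
move=> ac1 ac2 ad1 ad2 c1p c2p d1p d2p cf Cf.
have [fE fE'] := (sm_findim MA, sm_findim MA').
have K c : atlas M c -> cdom c p -> cinv c (cmap c p) = p.
  by move=> ac; exact: cmapK (sm_chart MA ac) _.
have C1 := smooth_transition MA ac2 ac1 c2p c1p.
have C2 := smooth_transition MA' ad1 ad2 d1p d2p.
have C3 : smooth_near ((cmap d2 \o cinv d1) \o ((cmap d1 \o f \o cinv c1) \o
    (cmap c1 \o cinv c2))) (cmap c2 p).
  apply: smooth_near_comp => //; last by rewrite /= !K.
  by apply: smooth_near_comp => //; rewrite /= K.
apply: near_eq_smooth C3.
have n1 := near_cinv MA ac2 c2p (near_cdom MA ac1 c1p).
have n2 := near_cinv MA ac2 c2p (cf _ (near_cdom MA' ad1 d1p)).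
near=> x => /=.
rewrite (cmapK (sm_chart MA ac1)); last by near: x.
by rewrite (cmapK (sm_chart MA' ad1)); last by near: x.
Unshelve. all: by end_near. Qed.

(** Smoothness in the preferred charts, the ones that define [mdiff]. Continuity is a separate
    clause: it keeps the values of [f] near [p] inside the domain of the chart at [f p], outside of
    which the chart expression is meaningless. *)
Definition msmooth_at E E' (M : charted E) (M' : charted E') (f : M -> M') (p : M) :=
  {for p, continuous f} /\
  smooth_near (cmap (chart_at (f p)) \o f \o cinv (chart_at p)) (cmap (chart_at p) p).

(** Transition maps are smooth, so testing all pairs of charts amounts to testing the preferred pair
    at each point. *)
Lemma msmooth_onP E E' (M : charted E) (M' : charted E') (U : set M) (f : M -> M') :
  smooth_atlas M -> smooth_atlas M' -> open U ->
  msmooth_on U f <-> forall p, U p -> msmooth_at f p.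
Proof.
move=> MA MA' oU.
have oimg c c' : atlas M c -> atlas M' c' -> (forall p, U p -> {for p, continuous f}) ->
    open (cmap c @` (U `&` cdom c `&` f @^-1` cdom c')).
  move=> ac ac' cf; apply: (open_cimg MA ac); last by move=> ? [[]].
  rewrite openE => p [[Up cp] c'p].
  have n1 : \forall q \near p, U q by apply: open_nbhs_nbhs.
  have n2 := near_cdom MA ac cp.
  have n3 := cf _ Up _ (near_cdom MA' ac' c'p).
  rewrite /interior; near=> q; split; [split|]; by near: q.
split=> [[cf Cf] p Up|h].
  split; first exact: cf.
  have [ac cp] := sm_chart_at MA p; have [ac' c'p] := sm_chart_at MA' (f p).
  have := Cf _ _ ac ac'; move/(smooth_onP _ (oimg _ _ ac ac' cf)); apply.
  by exists p.
have cf p : U p -> {for p, continuous f} by move=> /h[].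
split=> // c c' ac ac'; apply/(smooth_onP _ (oimg _ _ ac ac' cf)).
move=> _ [p [[Up cp] c'p] <-]; have [_] := h _ Up.
have [acp cpp] := sm_chart_at MA p; have [acf cff] := sm_chart_at MA' (f p).
by apply: (smooth_chart_change MA MA') => //; exact: cf.
Unshelve. all: by end_near. Qed.

Lemma msmoothP E E' (M : charted E) (M' : charted E') (f : M -> M') :
  smooth_atlas M -> smooth_atlas M' -> msmooth f <-> forall p, msmooth_at f p.
Proof.
move=> MA MA'; rewrite /msmooth msmooth_onP //; last exact: openT.
by split=> h p; [exact: h|move=> _].
Qed.

Lemma chart_atK E (M : charted E) : smooth_atlas M -> forall p : M,
  cinv (chart_at p) (cmap (chart_at p) p) = p.
Proof.
by move=> MA p; have [ac cp] := sm_chart_at MA p; exact: cmapK (sm_chart MA ac) _ cp.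
Qed.

Lemma near_chart_at E (M : charted E) : smooth_atlas M -> forall (p : M) (P : set M),
  (\forall q \near p, P q) ->
  \forall x \near cmap (chart_at p) p, P (cinv (chart_at p) x).
Proof.
move=> MA p P; have [ac cp] := sm_chart_at MA p; exact: near_cinv.
Qed.

Lemma near_eq_msmooth E E' (M : charted E) (M' : charted E') (f g : M -> M') p :
  smooth_atlas M -> (\forall q \near p, f q = g q) -> msmooth_at f p ->
  msmooth_at g p /\ mdiff g p = mdiff f p.
Proof.
move=> MA fg [cf Cf].
have fgp : f p = g p := nbhs_singleton fg.
have nfg : \forall x \near cmap (chart_at p) p,
    (cmap (chart_at (f p)) \o f \o cinv (chart_at p)) x =
    (cmap (chart_at (g p)) \o g \o cinv (chart_at p)) x.
  by have := near_chart_at MA fg; apply: filterS => x; rewrite fgp /= => ->.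
split; last first.
  by have [] := near_eq_diff nfg (smooth_near_differentiable Cf).
split; last exact: near_eq_smooth Cf.
move=> A; rewrite -fgp => /cf nA; apply: filterS2 fg nA => q.
by rewrite /= => ->.
Qed.

Lemma msmooth_comp E1 E2 E3 (M1 : charted E1) (M2 : charted E2) (M3 : charted E3)
    (f : M1 -> M2) (g : M2 -> M3) p :
  smooth_atlas M1 -> smooth_atlas M2 ->
  msmooth_at f p -> msmooth_at g (f p) ->
  msmooth_at (g \o f) p /\
  forall v, mdiff (g \o f) p v = mdiff g (f p) (mdiff f p v).
Proof.
move=> MA1 MA2 [cf Cf] [cg Cg].
have [ac cp] := sm_chart_at MA1 p; have [ad dp] := sm_chart_at MA2 (f p).
have nE : \forall x \near cmap (chart_at p) p,
    ((cmap (chart_at (g (f p))) \o g \o cinv (chart_at (f p))) \o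
     (cmap (chart_at (f p)) \o f \o cinv (chart_at p))) x =
    (cmap (chart_at ((g \o f) p)) \o (g \o f) \o cinv (chart_at p)) x.
  have := near_chart_at MA1 (cf _ (near_cdom MA2 ad dp)).
  by apply: filterS => x dx /=; rewrite (cmapK (sm_chart MA2 ad)).
have Cg' : smooth_near (cmap (chart_at (g (f p))) \o g \o cinv (chart_at (f p)))
    ((cmap (chart_at (f p)) \o f \o cinv (chart_at p)) (cmap (chart_at p) p)).
  by rewrite /= chart_atK.
have Cgf := smooth_near_comp (sm_findim MA2) Cf Cg'.
split; first split.
- exact: continuous_comp.
- exact: (near_eq_smooth nE Cgf).
move=> v; rewrite /mdiff.
have [_ ->] := near_eq_diff nE (smooth_near_differentiable Cgf).
rewrite (diff_comp_apply v (smooth_near_differentiable Cf)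
  (smooth_near_differentiable Cg')).
by rewrite /= chart_atK.
Qed.

Lemma msmooth_id E (M : charted E) p : smooth_atlas M ->
  msmooth_at (id : M -> M) p /\ forall v, mdiff (id : M -> M) p v = v.
Proof.
move=> MA; have [ac cp] := sm_chart_at MA p.
have nE : \forall x \near cmap (chart_at p) p,
    id x = (cmap (chart_at p) \o id \o cinv (chart_at p)) x.
  have := near_cimg MA ac cp; apply: filterS => x ix /=.
  by rewrite (cinvK MA ac).
have Ci := smooth_near_id (cmap (chart_at p) p).
split; first by split; [exact: cvg_id|exact: near_eq_smooth Ci].
move=> v; rewrite /mdiff.
have [_ ->] := near_eq_diff nE (smooth_near_differentiable Ci).
by rewrite diff_val.
Qed.

Lemma msmooth_cst E E' (M : charted E) (M' : charted E') (a : M') p :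
  msmooth_at (fun _ : M => a) p /\
  forall v, mdiff (fun _ : M => a) p v = 0.
Proof.
split; first by split; [exact: cst_continuous|exact: smooth_near_cst].
by move=> v; rewrite /mdiff (_ : _ \o _ = cst (cmap (chart_at a) a)) // diff_cst.
Qed.

Lemma msmooth_linear E E' (L : E -> E') (p : charted_vec E) : linear L -> continuous L ->
  msmooth_at (L : charted_vec E -> charted_vec E') p /\
  mdiff (L : charted_vec E -> charted_vec E') p = L.
Proof.
move=> Ll Lc; split; first by split; [exact: Lc|exact: linear_smooth].
have [_ dL] := linear_diff p Ll Lc; exact: dL.
Qed.

Lemma mdiff_linear E E' (M : charted E) (M' : charted E') (f : M -> M') p :
  linear (mdiff f p).
Proof. exact: linearP. Qed.

Lemma msmooth_lift E1 E2 E3 (M1 : charted E1) (M2 : charted E2) (M3 : charted E3)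
    (F : M2 -> M3) (s : M1 -> M2) p :
  smooth_atlas M1 -> smooth_atlas M2 -> smooth_atlas M3 ->
  (\forall q \near p, {for q, continuous s}) ->
  msmooth_at F (s p) -> msmooth_at (F \o s) p -> injective (mdiff F (s p)) ->
  msmooth_at s p.
Proof.
move=> MA1 MA2 MA3 cs [cF CF] [cFs CFs] inj.
have csp := nbhs_singleton cs.
have [ac cp] := sm_chart_at MA1 p; have [ad dp] := sm_chart_at MA2 (s p).
split=> //.
have nd := csp _ (near_cdom MA2 ad dp).
apply: (@smooth_lift _ _ _ _ (cmap (chart_at (F (s p))) \o F \o cinv (chart_at (s p)))).
- exact: sm_findim MA2.
- exact: sm_findim MA3.
- have n1 := near_chart_at MA1 cs.
  have n2 := near_chart_at MA1 nd.
  have n3 := near_cimg MA1 ac cp.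
  near=> x.
  have ix : (cmap (chart_at p) @` cdom (chart_at p)) x by near: x.
  have sx : cdom (chart_at (s p)) (s (cinv (chart_at p) x)) by near: x.
  apply: (@continuous_comp _ _ _ (s \o cinv (chart_at p)) (cmap (chart_at (s p)))).
    apply: continuous_comp; first exact: (cinv_cont (sm_chart MA1 ac) ix).
    by near: x.
  exact: (cmap_cont (sm_chart MA2 ad) sx).
- by rewrite /= chart_atK.
- apply: near_eq_smooth CFs; have := near_chart_at MA1 nd; apply: filterS => x dx /=.
  by rewrite (cmapK (sm_chart MA2 ad)).
- by rewrite /= chart_atK.
Unshelve. all: by end_near. Qed.

End Manifolds.

(** * Products of manifolds *)

Section Products.
Variable R : realType.
Implicit Types E : normedModType R.

Lemma open_setM (T1 T2 : topologicalType) (A : set T1) (B : set T2) :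
  open A -> open B -> open (A `*` B).
Proof.
move=> oA oB; rewrite openE => -[x y] [/= Ax By].
by exists (A, B) => //; split; exact: open_nbhs_nbhs.
Qed.

Lemma fst_smooth (V W : normedModType R) (x : (V * W)%type) :
  smooth_near (fst : (V * W)%type -> V) x.
Proof. by apply: linear_smooth => // y; exact: cvg_fst. Qed.

Lemma snd_smooth (V W : normedModType R) (x : (V * W)%type) :
  smooth_near (snd : (V * W)%type -> W) x.
Proof. by apply: linear_smooth => // y; exact: cvg_snd. Qed.

Section Prod.
Variables (E1 E2 : normedModType R) (M1 : charted E1) (M2 : charted E2).
Hypotheses (MA1 : smooth_atlas M1) (MA2 : smooth_atlas M2).
Local Notation P := (charted_prod M1 M2).

Lemma prod_chart_image (c1 : chart E1 M1) (c2 : chart E2 M2) A1 A2 :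
  cmap (prod_chart c1 c2) @` (A1 `*` A2) = (cmap c1 @` A1) `*` (cmap c2 @` A2).
Proof.
apply/seteqP; split=> [_ [[p1 p2] [/= a1 a2] <-]|[_ _] [/= [p1 a1 <-] [p2 a2 <-]]].
  by split; [exists p1|exists p2].
by exists (p1, p2).
Qed.

Lemma prod_atlas : smooth_atlas P.
Proof.
have [fE1 ic1 cc1 ca1] := MA1; have [fE2 ic2 cc2 ca2] := MA2.
split; first exact: findim_prod.
- move=> _ [c1 [c2 [a1 a2 ->]]].
  have [q1 i1 K1 m1 v1] := ic1 _ a1; have [q2 i2 K2 m2 v2] := ic2 _ a2.
  split.
  + exact: open_setM.
  + by rewrite prod_chart_image; exact: open_setM.
  + by move=> [p1 p2] [/= d1 d2]; rewrite K1 ?K2.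
  + move=> [p1 p2] [/= d1 d2].
    apply: cvg_pair; apply: cvg_comp; [exact: cvg_fst|exact: m1|exact: cvg_snd|exact: m2].
  + move=> [x1 x2]; rewrite prod_chart_image => -[/= d1 d2].
    apply: cvg_pair; apply: cvg_comp; [exact: cvg_fst|exact: v1|exact: cvg_snd|exact: v2].
- move=> _ _ [c1 [c2 [a1 a2 ->]]] [c1' [c2' [a1' a2' ->]]].
  have -> : cdom (prod_chart c1 c2) `&` cdom (prod_chart c1' c2') =
     (cdom c1 `&` cdom c1') `*` (cdom c2 `&` cdom c2').
    by apply/seteqP; split=> [x [[/= ? ?] [? ?]]|x [/= [? ?] [? ?]]].
  rewrite prod_chart_image; apply/smooth_onP.
    apply: open_setM.
      apply: (open_cimg MA1 a1); last by move=> ? [].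
      by apply: openI; apply: cdom_open; exact: ic1.
    apply: (open_cimg MA2 a2); last by move=> ? [].
    by apply: openI; apply: cdom_open; exact: ic2.
  move=> [_ _] [/= [p1 [d1 d1'] <-] [p2 [d2 d2'] <-]].
  apply: (@smooth_near_pair _ _ _ _ ((cmap c1' \o cinv c1) \o fst)
    ((cmap c2' \o cinv c2) \o snd)).
    by apply: smooth_near_comp; [|exact: fst_smooth|exact: (smooth_transition MA1)].
  by apply: smooth_near_comp; [|exact: snd_smooth|exact: (smooth_transition MA2)].
- move=> [p1 p2]; have [a1 d1] := ca1 p1; have [a2 d2] := ca2 p2; split.
    by exists (chart_at p1), (chart_at p2).
  by split.
Qed.

Lemma msmooth_fst (p : P) : msmooth_at (fst : P -> M1) p /\
  forall v, mdiff (fst : P -> M1) p v = v.1.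
Proof.
have [a1 d1] := sm_chart_at MA1 p.1.
have nE : \forall x \near cmap (chart_at p) p,
    fst x = (cmap (chart_at p.1) \o fst \o cinv (chart_at p)) x.
  have n1 := near_cimg MA1 a1 d1.
  have n2 : \forall x \near cmap (chart_at p) p,
      (cmap (chart_at p.1) @` cdom (chart_at p.1)) x.1.
    by apply: cvg_fst; exact: n1.
  apply: filterS n2 => x ix /=.
  by rewrite (cinvK MA1 a1 ix).
have C := fst_smooth (cmap (chart_at p) p : (E1 * E2)%type).
split; first by split; [exact: cvg_fst|exact: near_eq_smooth C].
move=> v; rewrite /mdiff.
have [_ ->] := near_eq_diff nE (smooth_near_differentiable C).
have fstc : continuous (fst : (E1 * E2)%type -> E1) by move=> x; exact: cvg_fst.
by have [//|_ ->] := linear_diff (cmap (chart_at p) p) _ fstc.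
Qed.

Lemma msmooth_snd (p : P) : msmooth_at (snd : P -> M2) p /\
  forall v, mdiff (snd : P -> M2) p v = v.2.
Proof.
have [a1 d1] := sm_chart_at MA2 p.2.
have nE : \forall x \near cmap (chart_at p) p,
    snd x = (cmap (chart_at p.2) \o snd \o cinv (chart_at p)) x.
  have n1 := near_cimg MA2 a1 d1.
  have n2 : \forall x \near cmap (chart_at p) p,
      (cmap (chart_at p.2) @` cdom (chart_at p.2)) x.2.
    by apply: cvg_snd; exact: n1.
  apply: filterS n2 => x ix /=.
  by rewrite (cinvK MA2 a1 ix).
have C := snd_smooth (cmap (chart_at p) p : (E1 * E2)%type).
split; first by split; [exact: cvg_snd|exact: near_eq_smooth C].
move=> v; rewrite /mdiff.
have [_ ->] := near_eq_diff nE (smooth_near_differentiable C).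
have sndc : continuous (snd : (E1 * E2)%type -> E2) by move=> x; exact: cvg_snd.
by have [//|_ ->] := linear_diff (cmap (chart_at p) p) _ sndc.
Qed.

Lemma msmooth_pair E (M : charted E) (f : M -> M1) (g : M -> M2) p :
  msmooth_at f p -> msmooth_at g p ->
  msmooth_at (fun x => (f x, g x) : P) p /\
  forall v, mdiff (fun x => (f x, g x) : P) p v = (mdiff f p v, mdiff g p v).
Proof.
move=> [cf Cf] [cg Cg]; split.
  by split; [exact: cvg_pair|exact: smooth_near_pair].
move=> v; have dfg := diff_pair (smooth_near_differentiable Cf)
  (smooth_near_differentiable Cg).
exact: (congr1 (fun h => h v) dfg).
Qed.

End Prod.
End Products.

(** * Inner products induced on quotients *)

Section Reduction.
Variable R : realType.

Definition inner_product m (b : 'rV[R]_m -> 'rV[R]_m -> R) :=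
  [/\ bilinear_form b, forall v w, b v w = b w v & forall v, v != 0 -> 0 < b v v].

Definition gram m (b : 'rV[R]_m -> 'rV[R]_m -> R) : 'M[R]_m :=
  \matrix_(i, j) b (delta_mx 0 i) (delta_mx 0 j).

Section Gram.
Variables (m : nat) (b : 'rV[R]_m -> 'rV[R]_m -> R).
Hypothesis bil : bilinear_form b.

Lemma bilin_suml (I : Type) (r : seq I) (c : I -> R) (e : I -> 'rV[R]_m) w :
  b (\sum_(i <- r) c i *: e i) w = \sum_(i <- r) c i * b (e i) w.
Proof.
have b0 : b 0 w = 0.
  by have := bil.1 (-1) 0 0 w; rewrite scaler0 addr0 mulN1r addNr.
by elim/big_rec2: _ => // i x y _ <-; rewrite bil.1.
Qed.

Lemma bilin_sumr (I : Type) (r : seq I) (c : I -> R) (e : I -> 'rV[R]_m) w :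
  b w (\sum_(i <- r) c i *: e i) = \sum_(i <- r) c i * b w (e i).
Proof.
have b0 : b w 0 = 0.
  by have := bil.2 (-1) 0 0 w; rewrite scaler0 addr0 mulN1r addNr.
by elim/big_rec2: _ => // i x y _ <-; rewrite bil.2.
Qed.

Lemma gramE v w : b v w = (v *m gram b *m w^T) 0 0.
Proof.
rewrite {1}(row_sum_delta v) bilin_suml mxE.
under eq_bigr => i _.
  rewrite {1}(row_sum_delta w) bilin_sumr big_distrr /=; over.
rewrite exchange_big /=; apply: eq_bigr => j _.
rewrite !mxE big_distrl /=; apply: eq_bigr => i _.
by rewrite !mxE mulrCA mulrC.
Qed.

End Gram.

Lemma gram_tr m (b : 'rV[R]_m -> 'rV[R]_m -> R) : (forall v w, b v w = b w v) ->
  (gram b)^T = gram b.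
Proof. by move=> bs; apply/matrixP => i j; rewrite !mxE. Qed.

Lemma inner_eq0 m (b : 'rV[R]_m -> 'rV[R]_m -> R) : inner_product b ->
  forall v, b v v = 0 -> v = 0.
Proof.
move=> [_ _ bp] v bv; apply/eqP; apply/negPn/negP => /bp.
by rewrite bv ltxx.
Qed.

(** [B *m gram b *m B^T] is the Gram matrix of [b] on the span of the rows of [B], where [b] is
    still definite. *)
Lemma gram_free m n (b : 'rV[R]_m -> 'rV[R]_m -> R) (B : 'M[R]_(n, m)) :
  inner_product b -> row_free B -> B *m gram b *m B^T \in unitmx.
Proof.
move=> ib Bf; have [bl _ _] := ib; rewrite -row_free_unit; apply: inj_row_free => x xC.
have : x *m B = 0.
  apply: (inner_eq0 ib); rewrite (gramE bl) trmx_mul !mulmxA.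
  by rewrite !mulmxA in xC; rewrite xC mul0mx mxE.
by rewrite -(mul0mx _ B); exact: row_free_inj.
Qed.

Lemma gram_unit m (b : 'rV[R]_m -> 'rV[R]_m -> R) : inner_product b ->
  gram b \in unitmx.
Proof.
move=> ib; have := @gram_free m m b 1%:M ib.
by rewrite trmx1 mul1mx mulmx1 row_free_unit unitmx1; apply.
Qed.

Definition orthogonal_to_ker m (W : nmodType) (b : 'rV[R]_m -> 'rV[R]_m -> R)
  (f : 'rV[R]_m -> W) (v : 'rV[R]_m) := forall w, f w = 0 -> b v w = 0.

(** [h] is [v] minus its [b]-orthogonal projection to the kernel. With the rows of [B] a basis of
    the kernel and [G] the Gram matrix, this projection is [v G B^T (B G B^T)^-1 B]. *)
Lemma lift_mx m k (b : 'rV[R]_m -> 'rV[R]_m -> R) (A : 'M[R]_(m, k)) v :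
  inner_product b -> exists2 h, h *m A = v *m A & orthogonal_to_ker b (mulmx^~ A) h.
Proof.
move=> ib; have [bl _ _] := ib.
have [r [B Bf BK]] : exists r, exists2 B : 'M[R]_(r, m), row_free B & (B :=: kermx A)%MS.
  exists (\rank (kermx A)), (row_base (kermx A)); first exact: row_base_free.
  exact: eq_row_base.
pose C := B *m gram b *m B^T.
have uC : C \in unitmx by exact: gram_free.
have BA : B *m A = 0 by apply/sub_kermxP; rewrite BK.
exists (v - v *m gram b *m B^T *m invmx C *m B).
  by rewrite mulmxBl -(mulmxA _ B) BA mulmx0 subr0.
move=> w wA; have : (w <= B)%MS by rewrite BK; exact/sub_kermxP.
move=> /submxP[y ->]; rewrite (gramE bl) trmx_mul !mulmxA !mulmxBl.
rewrite -(mulmxA _ B) -(mulmxA _ (B *m _)) -/C -(mulmxA _ (invmx C)).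
by rewrite mulVmx // mulmx1 subrr mxE.
Qed.

(* In row vector notation, [A] is the matrix of a map onto ['rV_k] and [G] that
   of an inner product; [A^T *m invmx G *m A] is the dual inner product restricted
   to the covectors pulled back along [A]. *)
Definition redmx m k (G : 'M[R]_m) (A : 'M[R]_(m, k)) : 'M[R]_k :=
  invmx (A^T *m invmx G *m A).

(** The matrix is the Gram matrix of [b] on the rows of [A^T *m invmx (gram b)], which are
    independent because [A] has full column rank. *)
Lemma redmx_unit m k (b : 'rV[R]_m -> 'rV[R]_m -> R) (A : 'M[R]_(m, k)) :
  inner_product b -> row_full A -> A^T *m invmx (gram b) *m A \in unitmx.
Proof.
move=> ib Af; have [bl bs _] := ib; have uG := gram_unit ib.
have ATf : row_free (A^T *m invmx (gram b)).
  apply: inj_row_free => x; rewrite mulmxA => /(congr1 (mulmx^~ (gram b))).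
  rewrite mulmxKV // mul0mx => xA.
  have : row_free A^T by rewrite /row_free mxrank_tr; exact: Af.
  by move=> /row_free_inj; apply; rewrite mul0mx.
have := gram_free ib ATf; rewrite mulmxKV //.
rewrite trmx_mul trmxK trmx_inv gram_tr //.
by rewrite mulmxA.
Qed.

(** The vector [h0], dual under [b] to the covector [w |-> l (w A)^T], has the same image as [h]
    under [A] and is orthogonal to the kernel. So [h - h0] lies in the kernel and is orthogonal to
    it, hence vanishes. *)
Lemma redmxE m k (b : 'rV[R]_m -> 'rV[R]_m -> R) (A : 'M[R]_(m, k)) h h' :
  inner_product b -> row_full A -> orthogonal_to_ker b (mulmx^~ A) h ->
  b h h' = (h *m A *m redmx (gram b) A *m (h' *m A)^T) 0 0.
Proof.
move=> ib Af hh; have [bl bs _] := ib; have uG := gram_unit ib.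
have uS := redmx_unit ib Af.
pose l := h *m A *m redmx (gram b) A.
pose h0 := l *m A^T *m invmx (gram b).
have h0E w : b h0 w = (l *m (w *m A)^T) 0 0.
  by rewrite (gramE bl) /h0 mulmxKV // trmx_mul mulmxA.
have h0A : h0 *m A = h *m A.
  by rewrite /h0 -!(mulmxA l) /l mulmxKV.
have dA : (h - h0) *m A = 0 by rewrite mulmxBl h0A subrr.
have bB w : b (h - h0) w = b h w - b h0 w.
  by rewrite !(gramE bl) !mulmxBl !mxE.
have : h - h0 = 0.
  by apply: (inner_eq0 ib); rewrite bB hh // h0E dA trmx0 mulmx0 mxE subr0.
by move/eqP; rewrite subr_eq0 => /eqP hE; rewrite {1}hE h0E.
Qed.

(** Under a change of basis [T] in the source the two factors cancel, so the form on the target does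
    not depend on the coordinates upstairs. *)
Lemma redmx_congr m k (T G : 'M[R]_m) (A : 'M[R]_(m, k)) :
  T \in unitmx -> G \in unitmx ->
  redmx (T *m G *m T^T) (T *m A) = redmx G A.
Proof.
move=> uT uG; rewrite /redmx; congr invmx.
have uTt : T^T \in unitmx by rewrite unitmx_tr.
have -> : invmx (T *m G *m T^T) = invmx T^T *m invmx G *m invmx T.
  apply: (can_inj (mulKmx (_ : T *m G *m T^T \in unitmx))).
    by rewrite !unitmx_mul uT uG uTt.
  rewrite mulmxV ?unitmx_mul ?uT ?uG ?uTt //.
  by rewrite !mulmxA mulmxK // mulmxK // mulmxV.
by rewrite trmx_mul !mulmxA mulmxK // mulmxKV.
Qed.

Lemma linear_mx m k (f : 'rV[R]_m -> 'rV[R]_k) : linear f ->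
  forall v, f v = v *m lin1_mx f.
Proof.
move=> fl v; pose F : {linear 'rV[R]_m -> 'rV[R]_k} :=
  HB.pack f (GRing.isLinear.Build _ _ _ _ _ fl).
exact: (esym (mul_rV_lin1 F v)).
Qed.

Lemma orthogonal_lift m k (b : 'rV[R]_m -> 'rV[R]_m -> R)
    (f : 'rV[R]_m -> 'rV[R]_k) v : inner_product b -> linear f ->
  exists2 h, f h = f v & orthogonal_to_ker b f h.
Proof.
move=> ib fl; have fE := linear_mx fl.
have [h hv hh] := lift_mx (lin1_mx f) v ib; exists h; first by rewrite !fE.
by move=> w; rewrite fE; exact: hh.
Qed.

Lemma trmx_linear m k (f : 'rV[R]_m -> 'cV[R]_k) : linear f ->
  linear (fun v => (f v)^T).
Proof. by move=> fl a u v; rewrite fl linearP. Qed.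

Lemma orthogonal_lift_dual m k (b : 'rV[R]_m -> 'rV[R]_m -> R)
    (f : 'rV[R]_m -> 'cV[R]_k) v : inner_product b -> linear f ->
  exists2 h, f h = f v & orthogonal_to_ker b f h.
Proof.
move=> ib fl; have [h hv hh] := orthogonal_lift v ib (trmx_linear fl).
exists h; first exact: trmx_inj.
by move=> w fw; apply: hh; rewrite fw trmx0.
Qed.

(** For [f] onto, the inner product that makes [f] isometric on the orthogonal complement of its
    kernel. The targets are duals of Lie algebras, hence column vectors; transposition returns to
    the row conventions of [redmx]. *)
Definition redform m k (b : 'rV[R]_m -> 'rV[R]_m -> R) (f : 'rV[R]_m -> 'cV[R]_k)
  (a a' : 'cV[R]_k) : R :=
  (a^T *m redmx (gram b) (lin1_mx (fun v => (f v)^T)) *m a') 0 0.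

Lemma redformE m k (b : 'rV[R]_m -> 'rV[R]_m -> R) (f : 'rV[R]_m -> 'cV[R]_k) h h' :
  inner_product b -> linear f -> (forall a, exists v, f v = a) ->
  orthogonal_to_ker b f h -> redform b f (f h) (f h') = b h h'.
Proof.
move=> ib fl fs hh; set A := lin1_mx (fun v => (f v)^T).
have fE v : (f v)^T = v *m A by exact: (linear_mx (trmx_linear fl)).
have Af : row_full A.
  rewrite -sub1mx; apply/row_subP => i; have [v fv] := fs (row i 1%:M)^T.
  by rewrite -(trmxK (row i _)) -fv fE submxMl.
rewrite (@redmxE _ _ _ A) //.
  by rewrite -!fE trmxK.
by move=> w wA; apply: hh; apply: trmx_inj; rewrite fE trmx0.
Qed.

Lemma mx_entry m k (X : 'M[R]_(m, k)) i j :
  X i j = (delta_mx (0 : 'I_1) i *m X *m (delta_mx (0 : 'I_1) j)^T) 0 0.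
Proof. by rewrite -rowE trmx_delta -colE !mxE. Qed.

(** Serves both for [T] the differential of an isometry that preserves the fibres and for [T] the
    differential of an inverse chart. *)
Lemma redform_congr m k (b : 'rV[R]_m -> 'rV[R]_m -> R) (f : 'rV[R]_m -> 'cV[R]_k)
    (T : 'rV[R]_m -> 'rV[R]_m) : inner_product b -> linear f -> linear T ->
  injective T ->
  redform (fun v w => b (T v) (T w)) (f \o T) = redform b f.
Proof.
move=> ib fl Tl Ti; have [bl _ _] := ib; apply/funext => a; apply/funext => a'.
have TE := linear_mx Tl; set TM := lin1_mx T in TE.
rewrite /redform (_ : gram _ = TM *m gram b *m TM^T); last first.
  apply/matrixP => i j; rewrite mxE !TE (gramE bl) trmx_mul.
  by rewrite [RHS]mx_entry !mulmxA.
rewrite (_ : lin1_mx _ = TM *m lin1_mx (fun v => (f v)^T)); last first.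
  apply/row_matrixP => i; rewrite row_mul.
  rewrite !rowE -(linear_mx (trmx_linear fl)) -TE.
  by rewrite -(@linear_mx _ _ (fun v => (f (T v))^T)) // => c u v; rewrite Tl fl linearP.
rewrite redmx_congr ?(gram_unit ib) //.
rewrite -row_free_unit; apply: inj_row_free => v; rewrite -TE => Tv.
apply: Ti; rewrite Tv.
by rewrite TE mul0mx.
Qed.

Lemma redform_inner m k (b : 'rV[R]_m -> 'rV[R]_m -> R) (f : 'rV[R]_m -> 'cV[R]_k) :
  inner_product b -> linear f -> (forall a, exists v, f v = a) ->
  [/\ bilinear_form (redform b f), forall a a', redform b f a a' = redform b f a' a &
      forall a, a != 0 -> 0 < redform b f a a].
Proof.
move=> ib fl fs; have [bl bs bp] := ib.
have lift a : exists2 h, f h = a & orthogonal_to_ker b f h.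
  by have [v <-] := fs a; exact: orthogonal_lift_dual.
have f0 : f 0 = 0 by have := fl (-1) 0 0; rewrite scaler0 addr0 scaleN1r addNr.
split.
- split=> c u v w; rewrite /redform.
    by rewrite linearP /= !mulmxDl -!scalemxAl !mxE.
  by rewrite mulmxDr -scalemxAr !mxE.
- move=> a a'; have [h <- hh] := lift a; have [h' <- hh'] := lift a'.
  by rewrite !redformE.
- move=> a; have [h <- hh] := lift a => fh0; rewrite redformE //; apply: bp.
  by apply: contraNneq fh0 => ->; rewrite f0.
Qed.

Lemma orthogonal_unique m k (b : 'rV[R]_m -> 'rV[R]_m -> R)
  (f : 'rV[R]_m -> 'cV[R]_k) (r r' : 'cV[R]_k -> 'cV[R]_k -> R) :
  inner_product b -> linear f -> (forall a, exists v, f v = a) ->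
  (forall h h', orthogonal_to_ker b f h -> orthogonal_to_ker b f h' ->
    r (f h) (f h') = b h h') ->
  (forall h h', orthogonal_to_ker b f h -> orthogonal_to_ker b f h' ->
    r' (f h) (f h') = b h h') ->
  forall a a', r a a' = r' a a'.
Proof.
move=> ib fl fs rE r'E a a'; have [v <-] := fs a; have [v' <-] := fs a'.
have [h <- hh] := orthogonal_lift_dual v ib fl.
have [h' <- hh'] := orthogonal_lift_dual v' ib fl.
by rewrite rE // r'E.
Qed.

(** Only products and inverses of matrices with smooth entries occur. Both inverses exist at [x] and
    invertibility is an open condition, so the algebraic hypotheses concern the point [x] alone. *)
Lemma smooth_redform (V : normedModType R) m k
    (b : V -> 'rV[R]_m -> 'rV[R]_m -> R) (f : V -> 'rV[R]_m -> 'cV[R]_k) x a a' :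
  (forall v w, smooth_near (fun x => b x v w : R^o) x) ->
  (forall v, smooth_near (fun x => f x v) x) ->
  inner_product (b x) -> linear (f x) -> (forall a, exists v, f x v = a) ->
  smooth_near (fun x => redform (b x) (f x) a a' : R^o) x.
Proof.
move=> Cb Cf ib fl fs.
pose A y := lin1_mx (fun v => (f y v)^T).
have CA : smooth_mx A x.
  move=> i j.
  apply: near_eq_smooth (smooth_near_linear_comp (@coord_linear R k 1 j 0) _
    (Cf (delta_mx 0 i))).
    by apply: nearW => y; rewrite !mxE.
  exact: coord_continuous.
have CG : smooth_mx (fun y => gram (b y)) x.
  move=> i j; apply: near_eq_smooth (Cb (delta_mx 0 i) (delta_mx 0 j)).
  by apply: nearW => y; rewrite mxE.
have Af : row_full (A x).
  rewrite -sub1mx; apply/row_subP => i; have [v fv] := fs (row i 1%:M)^T.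
  by rewrite -(trmxK (row i _)) -fv (linear_mx (trmx_linear fl)) submxMl.
apply: smooth_mulmx; last exact: smooth_cst_mx.
apply: smooth_mulmx; first exact: smooth_cst_mx.
apply: smooth_invmx; last exact: redmx_unit.
apply: smooth_mulmx => //; apply: smooth_mulmx; first exact: smooth_trmx.
by apply: smooth_invmx => //; exact: gram_unit.
Qed.

End Reduction.

(** * Reduced metrics *)

Section Reduced.
Variable R : realType.

Lemma dual_atlas d : smooth_atlas (dual R d).
Proof. exact/vec_atlas/findim_cV. Qed.

Lemma mdiff0 (E E' : normedModType R) (M : charted E) (M' : charted E')
  (f : M -> M') p : mdiff f p 0 = 0.
Proof. exact: linear0. Qed.

Lemma mdiffB (E E' : normedModType R) (M : charted E) (M' : charted E')
  (f : M -> M') p u v : mdiff f p (u - v) = mdiff f p u - mdiff f p v.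
Proof. exact: linearB. Qed.

Lemma mdiff_inj (E E' : normedModType R) (M : charted E) (M' : charted E')
  (f : M -> M') p : (forall v, mdiff f p v = 0 -> v = 0) -> injective (mdiff f p).
Proof.
move=> h u v uv; apply/eqP; rewrite -subr_eq0; apply/eqP/h.
by rewrite mdiffB uv subrr.
Qed.

Lemma mdiff_retract (E E' : normedModType R) (M : charted E) (M' : charted E')
    (f : M -> M') (f' : M' -> M) p :
  smooth_atlas M -> smooth_atlas M' -> msmooth_at f p -> msmooth_at f' (f p) ->
  (\forall q \near p, f' (f q) = q) -> cancel (mdiff f p) (mdiff f' (f p)).
Proof.
move=> MA MA' Cf Cf' ff' v.
have [C E1] := msmooth_comp MA MA' Cf Cf'.
have [Ci Ei] := msmooth_id p MA.
have nE : \forall q \near p, id q = (f' \o f) q.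
  by apply: filterS ff' => q; rewrite /= => ->.
by rewrite -E1; have [_ ->] := near_eq_msmooth MA nE Ci; rewrite Ei.
Qed.

Section Chart.
Variables (m : nat) (M : manifold R m) (c : chart 'rV[R]_m M) (ac : atlas M c).
Let MA := manifold_atlas M.
Let VA := vec_atlas (findim_rV R m).

Lemma msmooth_cinv (x : charted_vec 'rV[R]_m) : (cmap c @` cdom c) x ->
  msmooth_at (cinv c : charted_vec 'rV[R]_m -> M) x.
Proof.
move=> [p cp <-]; split.
  by apply: (cinv_cont (mchart ac)); exists p.
have [ap dp] := mchart_at (cinv c (cmap c p)).
apply: (@smooth_transition _ _ _ MA) => //.
by rewrite (cmapK (mchart ac)) in dp *.
Qed.

Lemma msmooth_cmap p : cdom c p ->
  msmooth_at (cmap c : M -> charted_vec 'rV[R]_m) p.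
Proof.
move=> cp; split; first exact: (cmap_cont (mchart ac)).
have [ap dp] := mchart_at p.
exact: (@smooth_transition _ _ _ MA).
Qed.

Lemma mdiff_cinv_inj (x : charted_vec 'rV[R]_m) : (cmap c @` cdom c) x ->
  injective (mdiff (cinv c : charted_vec 'rV[R]_m -> M) x).
Proof.
move=> ix; have Ci := msmooth_cinv ix.
have Cm := msmooth_cmap (cinv_dom MA ac ix).
apply: can_inj (mdiff_retract VA MA Ci Cm _).
have oi := cimg_open (mchart ac).
have ni : nbhs x (cmap c @` cdom c) by apply: open_nbhs_nbhs.
by apply: filterS ni => y iy; exact: (cinvK MA ac iy).
Qed.

End Chart.

Lemma in_chart_dual k (T : tensor2 (dual R k)) (x : 'cV[R]_k) v w :
  in_chart T (@Chart R 'cV[R]_k 'cV[R]_k setT id id) x v w = T x v w.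
Proof.
have [_ Ei] := msmooth_id (x : dual R k) (dual_atlas k).
by rewrite /in_chart /pullback
  !(Ei : forall v, mdiff (id : charted_vec 'cV[R]_k -> dual R k) x v = v).
Qed.

(** * Existence and uniqueness of the metric on the image of a submersion *)

Section ReducedMetric.
Variables (m k : nat) (M : manifold R m) (g : tensor2 M) (f : M -> dual R k).
Hypothesis rg : riemannian_metric g.
Hypothesis Cf : forall p, msmooth_at f p.
Hypothesis sf : forall p a, exists v, mdiff f p v = a.
Let MA := manifold_atlas M.
Let DA := dual_atlas k.

Lemma metric_inner p : inner_product (g p).
Proof.
by split; [exact: (rm_bilinear rg I)|exact: (rm_sym rg I)|exact: (rm_pos rg I)].
Qed.

(** The reduced form seen from the point [p] of the fibre; it defines a form on the base once it is
    constant along fibres. *)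
Definition fibre_form p : 'cV[R]_k -> 'cV[R]_k -> R := redform (g p) (mdiff f p).

Lemma fibre_form_isometry (phi : M -> M) p : msmooth_at phi p ->
  injective (mdiff phi p) -> (forall q, f (phi q) = f q) ->
  (forall v w, g (phi p) (mdiff phi p v) (mdiff phi p w) = g p v w) ->
  fibre_form (phi p) = fibre_form p.
Proof.
move=> Cp ip fp gp; rewrite /fibre_form.
have e1 : (fun v w => g (phi p) (mdiff phi p v) (mdiff phi p w)) = g p.
  by apply/funext => v; apply/funext => w; exact: gp.
have e2 : mdiff f (phi p) \o mdiff phi p = mdiff f p.
  apply/funext => v /=; have [_ <-] := msmooth_comp MA MA Cp (Cf (phi p)).
  by rewrite (_ : f \o phi = f) //; apply/funext => q; exact: fp.
have e3 := redform_congr (metric_inner (phi p)) (mdiff_linear f (phi p))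
  (mdiff_linear phi p) ip.
exact: (etrans (esym e3) (f_equal2 (@redform R m k) e1 e2)).
Qed.

(** The preferred chart may jump with [p], so [fibre_form] is rewritten in one fixed chart before
    its smoothness in [p] is discussed; [redform_congr] absorbs the change of coordinates. *)
Lemma fibre_form_chart (c : chart 'rV[R]_m M) p : atlas M c -> cdom c p ->
  fibre_form p = redform (in_chart g c (cmap c p)) ('d (f \o cinv c) (cmap c p)).
Proof.
move=> ac cp; have ix : (cmap c @` cdom c) (cmap c p) by exists p.
have K : cinv c (cmap c p) = p by exact: cmapK (mchart ac) _ cp.
have e2 : mdiff f (cinv c (cmap c p)) \o
    mdiff (cinv c : charted_vec 'rV[R]_m -> M) (cmap c p) =
    'd (f \o cinv c) (cmap c p).
  apply/funext => v /=.
  by have [_ <-] := msmooth_comp (vec_atlas (findim_rV R m)) MA (msmooth_cinv ac ix) (Cf _).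
have e3 := redform_congr (metric_inner (cinv c (cmap c p)))
  (mdiff_linear f (cinv c (cmap c p)))
  (mdiff_linear (cinv c : charted_vec 'rV[R]_m -> M) (cmap c p))
  (mdiff_cinv_inj ac ix).
have e4 : fibre_form (cinv c (cmap c p)) =
    redform (in_chart g c (cmap c p)) ('d (f \o cinv c) (cmap c p)).
  exact: (etrans (esym e3) (f_equal2 (@redform R m k) erefl e2)).
by rewrite K in e4.
Qed.

Lemma smooth_fibre_form (s : dual R k -> M) (b : dual R k) v w : msmooth_at s b ->
  smooth_near (fun y => fibre_form (s y) v w : R^o) b.
Proof.
move=> [cs Cs]; have [ac cp] := mchart_at (s b); set c := chart_at (s b) in ac cp Cs.
have C : smooth_near ((fun x => redform (in_chart g c x) ('d (f \o cinv c) x) v w : R^o)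
    \o (cmap c \o s)) b.
  apply: smooth_near_comp; [exact: findim_rV|exact: Cs|].
  have ix : (cmap c @` cdom c) (cmap c (s b)) by exists (s b).
  apply: smooth_redform.
  - move=> u u'.
    have oi : open (cmap c @` (setT `&` cdom c)).
      by rewrite setTI; exact: cimg_open (mchart ac).
    have /(smooth_onP _ oi) := rm_smooth rg ac u u'; apply.
    by rewrite setTI.
  - by move=> u; apply: smooth_near_diff; have [_] := Cf (s b).
  - have [bl bs bp] := metric_inner (s b).
    rewrite /in_chart /pullback /= (cmapK (mchart ac)) //.
    have T0 := mdiff_linear (cinv c : charted_vec 'rV[R]_m -> M) (cmap c (s b)).
    split.
    + by split=> a u1 u2 u3; rewrite T0 ?bl.1 ?bl.2.
    + by move=> u1 u2; rewrite bs.
    + move=> u u0; apply: bp; apply: contra_neq u0 => Tu.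
      by apply: (mdiff_cinv_inj ac ix); rewrite Tu mdiff0.
  - exact: linearP.
  (* A preimage under ['d (f \o cinv c)] is the chart image of a preimage [u] under [mdiff f]. *)
  - move=> a; have [u <-] := sf (s b) a.
    have Cm := msmooth_cmap ac cp.
    exists (mdiff (cmap c : M -> charted_vec 'rV[R]_m) (s b) u).
    have Ci := msmooth_cinv ac ix.
    have nK : \forall q \near s b, cinv c (cmap c q) = q.
      apply: filterS (near_cdom MA ac cp) => q; exact: cmapK (mchart ac) _.
    have VA := vec_atlas (findim_rV R m).
    have Cfi : msmooth_at f ((cinv c : charted_vec 'rV[R]_m -> M) (cmap c (s b))).
      exact: Cf.
    have [_ E1] := msmooth_comp VA MA Ci Cfi.
    have := E1 (mdiff (cmap c : M -> charted_vec 'rV[R]_m) (s b) u).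
    rewrite (mdiff_retract MA VA Cm Ci nK) (cmapK (mchart ac)) //.
apply: near_eq_smooth C.
have nc : \forall y \near (b : 'cV[R]_k), cdom c (s y).
  exact: cs _ (near_cdom MA ac cp).
apply: filterS nc => y cy /=.
by rewrite (fibre_form_chart ac cy).
Qed.

Lemma reduced_metric_exists :
  (forall p p', f p = f p' -> fibre_form p = fibre_form p') ->
  (forall b, range f b -> exists U (s : dual R k -> M),
     [/\ open U, U b, forall y, U y -> msmooth_at s y & forall y, U y -> f (s y) = y]) ->
  exists h, reduced_metric g f h.
Proof.
move=> ffE sec.
(* For empty [M] the requirements are vacuous and the zero tensor serves; otherwise [p0] is the
   default outside the image. *)
have [p0|np] := pselect (exists p : M, True); last first.
  exists (fun _ _ _ => 0); split; split => //; try by move=> b [p]; case: np; exists p.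
  - move=> c ac v w.
    by move=> n; apply: Ck_on_local => x [b [[p _ _] _] _]; case: np; exists p.
  - split; first exact/(msmoothP _ MA DA).
    exact: sf.
  - by move=> p; case: np; exists p.
(* [ch] picks a point in each fibre with no regularity at all. As [fibre_form] is constant on
   fibres, [h] nevertheless agrees, near each point of the image, with [fibre_form] along a smooth
   section. *)
pose ch b := if pselect (exists p, f p = b) is left e
  then projT1 (cid e) else projT1 (cid p0).
have chE p : f (ch (f p)) = f p.
  rewrite /ch; case: pselect => [e|ne]; first exact: (projT2 (cid e)).
  by case: ne; exists p.
pose h b := fibre_form (ch b).
have hE p : h (f p) = fibre_form p by apply: ffE; exact: chE.
exists h; split; last split.
- have inn p : _ := redform_inner (metric_inner p) (mdiff_linear f p) (sf p).
  split.
  + by move=> _ [p _ <-]; rewrite hE; have [] := inn p.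
  + by move=> _ [p _ <-]; rewrite hE; have [] := inn p.
  + by move=> _ [p _ <-]; rewrite hE; have [] := inn p.
  + move=> c -> v w n; apply: Ck_on_local => _ [b [rb _] <-].
    have [U [s [oU Ub Cs fs]]] := sec b rb.
    suff [B oB CB] : smooth_near (fun x : 'cV[R]_k => in_chart h
      (@Chart R 'cV[R]_k 'cV[R]_k setT id id) x v w : R^o) b by exists B => //; exact: CB.
    apply: near_eq_smooth (smooth_fibre_form v w (Cs b Ub)).
    have nU : \forall y \near b, U y by apply: open_nbhs_nbhs.
    apply: filterS nU => y Uy; rewrite in_chart_dual.
    by rewrite -{2}(fs y Uy) hE.
- by split; [exact/(msmoothP _ MA DA)|exact: sf].
- move=> p v w hv hw; rewrite hE; apply: redformE => //.
  + exact: metric_inner.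
  + exact: mdiff_linear.
Qed.

Lemma reduced_metric_unique h h' : reduced_metric g f h -> reduced_metric g f h' ->
  forall y, range f y -> forall v w, h' y v w = h y v w.
Proof.
move=> [_ [_ hE]] [_ [_ h'E]] _ [p _ <-].
apply: (orthogonal_unique (metric_inner p) (mdiff_linear f p) (sf p)).
- by move=> v w hv hw; exact: h'E.
- by move=> v w hv hw; exact: hE.
Qed.

End ReducedMetric.
End Reduced.

(** * Group actions and principal bundles *)

Section Actions.
Variable R : realType.

Section Group.
Variables (d : nat) (H : lieGroup R d).
Let HA := manifold_atlas H.

Lemma lmulVr (x : H) : lmul x (linv x) = lone H.
Proof.
rewrite -[LHS]lmul1 -[X in lmul X _](lmulV (linv x)) -lmulA.
by rewrite [lmul (linv x) _]lmulA lmulV lmul1 lmulV.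
Qed.

Lemma lmul1r (x : H) : lmul x (lone H) = x.
Proof. by rewrite -(lmulV x) lmulA lmulVr lmul1. Qed.

Lemma msmooth_lmulr (k x : H) : msmooth_at (fun x : H => lmul x k : H) x.
Proof.
have C := (msmoothP _ (prod_atlas HA HA) HA).1 (@lmul_smooth _ _ H) (x, k).
have [Ci _] := msmooth_id x HA.
have [Cc _] := msmooth_cst (M := H) k x.
have [Cp _] := msmooth_pair Ci Cc.
by have [] := msmooth_comp (f := fun x => (x, k) : charted_prod H H) HA
  (prod_atlas HA HA) Cp C.
Qed.

Lemma mdiff_lmulr_surj (k : H) w : exists w0,
  mdiff (fun x : H => lmul x k : H) (lone H) w0 = w.
Proof.
exists (mdiff (fun x : H => lmul x (linv k) : H) k w).
have [_ E] := msmooth_comp HA HA (msmooth_lmulr (linv k) k)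
  (msmooth_lmulr k (lmul k (linv k))).
have := E w; rewrite lmulVr => <-.
have [_ Ei] := msmooth_id k HA.
rewrite (_ : _ \o _ = id) ?Ei //.
by apply/funext => x /=; rewrite -lmulA lmulV lmul1r.
Qed.

End Group.

Section Action.
Variables (d : nat) (H : lieGroup R d) (E : normedModType R) (M : charted E).
Variable act : H -> M -> M.
Hypotheses (MA : smooth_atlas M) (sa : smooth_action act).
Let HA := manifold_atlas H.

Lemma msmooth_action (k : H) (p : M) :
  msmooth_at (fun x : charted_prod H M => act x.1 x.2 : M) (k, p).
Proof. exact: ((msmoothP _ (prod_atlas HA MA) MA).1 (sa_smooth sa)). Qed.

Lemma msmooth_act (k : H) (p : M) : msmooth_at (act k) p.
Proof.
have [Ci _] := msmooth_id p MA.
have [Cc _] := msmooth_cst (M := M) k p.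
have [Cp _] := msmooth_pair Cc Ci.
by have [] := msmooth_comp (f := fun q => (k, q) : charted_prod H M) MA
  (prod_atlas HA MA) Cp (msmooth_action k p).
Qed.

Lemma msmooth_orbit (p : M) (k : H) : msmooth_at (fun x : H => act x p : M) k.
Proof.
have [Ci _] := msmooth_id k HA.
have [Cc _] := msmooth_cst (M := H) p k.
have [Cp _] := msmooth_pair Ci Cc.
by have [] := msmooth_comp (f := fun x => (x, p) : charted_prod H M) HA
  (prod_atlas HA MA) Cp (msmooth_action k p).
Qed.

Lemma act_linvK (k : H) (p : M) : act (linv k) (act k p) = p.
Proof. by rewrite -(sa_mul sa) lmulV (sa_one sa). Qed.

Lemma mdiff_act_inj (k : H) (p : M) : injective (mdiff (act k) p).
Proof.
apply: can_inj (mdiff_retract MA MA (msmooth_act k p) (msmooth_act (linv k) _) _).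
by apply: nearW => q; exact: act_linvK.
Qed.

(* The orbit map of [p] precomposed with right translation by [k] is the orbit
   map of [k.p], so only the differential at the unit matters. *)
Lemma mdiff_orbit_inj (k : H) (p : M) :
  (forall xi, generated_field act xi (act k p) = 0 -> xi = 0) ->
  injective (mdiff (fun x : H => act x p : M) k).
Proof.
move=> inf; apply: mdiff_inj => w.
have [w0 <-] := mdiff_lmulr_surj k w.
have Co : msmooth_at (fun x : H => act x p : M) (lmul (lone H) k) by exact: msmooth_orbit.
have [_ E1] := msmooth_comp HA HA (msmooth_lmulr k (lone H)) Co.
have := E1 w0; rewrite lmul1 => <-.
rewrite (_ : _ \o _ = fun x : H => act x (act k p)); last first.
  by apply/funext => x /=; rewrite (sa_mul sa).
by move=> /inf ->; rewrite mdiff0.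
Qed.

(** If the field generated by [xi] vanishes at [p], the moment map equation makes [xi] pair to zero
    with the image of [mdiff mu p], which is the whole dual. *)
Lemma moment_inj (omega : tensor2 M) (mu : M -> dual R d) p :
  symplectic_form omega -> hamiltonian_action omega act mu ->
  (forall a, exists v, mdiff mu p v = a) ->
  forall xi, generated_field act xi p = 0 -> xi = 0.
Proof.
move=> so ha smu xi X0; apply/rowP => j; rewrite mxE.
have [v vE] := smu (delta_mx j 0).
have := ha_momentum ha xi p v; rewrite X0 vE /pairing.
have [bl _] := sf_bilinear so p.
have -> : omega p 0 v = 0.
  by have := bl (-1) 0 0 v; rewrite scaler0 addr0 mulN1r addNr.
rewrite -colE !mxE => /eqP; rewrite eq_sym oppr_eq0 => /eqP //.
Qed.

End Action.

(** * Sections and fibres of a principal bundle *)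

Section Bundle.
Variables (d m k : nat) (H : lieGroup R d) (M : manifold R m).
Variables (act : H -> M -> M) (f : M -> dual R k).
Hypothesis pb : principal_bundle act f.
Let HA := manifold_atlas H.
Let MA := manifold_atlas M.
Let DA := dual_atlas R k.

Lemma bundle_section p : exists U (s : dual R k -> M),
  [/\ open U, U (f p), s (f p) = p, forall y, U y -> msmooth_at s y &
      forall y, U y -> f (s y) = y].
Proof.
have [U [t [t' [Ub [[oV oW] tt' t't Ct Ct'] t1 t2]]]] :=
  pb_trivial pb (ex_intro2 _ _ p I erefl).
(* The fibre coordinate of [p], so that the section [y |-> t' (y, h)] passes through [p]. *)
pose h : H := (t p).2.
(* Only the product of [U] with the group is known to be open; slicing it at [h] gives [U]. *)
have oU : open U.
  rewrite openE => y Uy.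
  have : nbhs ((y, h) : charted_prod (dual R k) H) (U `*` setT).
    by apply: open_nbhs_nbhs.
  move=> [[A B] /= [nA nB] AB]; apply: filterS nA => z Az.
  by have [] := AB (z, h) (conj Az (nbhs_singleton nB)).
have fs y : U y -> U (f (t' (y, h))) /\ f (t' (y, h)) = y.
  by move=> Uy; have [Vt tK] := t't (y, h) (conj Uy I); split=> //; rewrite -t1 // tK.
exists U, (fun y => t' (y, h)); split => //.
- by have [_ tK] := tt' p Ub; rewrite -[RHS]tK -t1 // /h -surjective_pairing.
- move=> y Uy.
  have [Ci _] := msmooth_id y DA.
  have [Cc _] := msmooth_cst (M := dual R k) h y.
  have [Cp _] := msmooth_pair Ci Cc.
  have PA := prod_atlas DA HA.
  have Ct'y := (msmooth_onP _ PA MA oW).1 Ct' (y, h) (conj Uy I).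
  by have [] := msmooth_comp (f := fun y => (y, h) : charted_prod (dual R k) H) DA PA
    Cp Ct'y.
- by move=> y /fs[].
Qed.

Lemma bundle_smooth p : msmooth_at f p.
Proof. exact: ((msmoothP _ MA DA).1 (pb_smooth pb)). Qed.

(** The differential of a local section through [p] is a right inverse. *)
Lemma bundle_submersion p a : exists v, mdiff f p v = a.
Proof.
have [U [s [oU Ub sp Cs fs]]] := bundle_section p.
exists (mdiff s (f p) a); rewrite -{1}sp.
apply: (mdiff_retract DA MA (Cs _ Ub) (bundle_smooth _)).
have nU : nbhs (f p) U by apply: open_nbhs_nbhs.
by apply: filterS nU.
Qed.

Lemma bundle_orbit p p' : f p = f p' -> exists h, p' = act h p.
Proof.
move=> fpp'.
have [U [t [t' [Ub [_ tt' t't _ _] t1 t2]]]] :=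
  pb_trivial pb (ex_intro2 _ _ p I erefl).
(* Left translation by this element carries the fibre coordinate of [p] to that of [p']. *)
exists (lmul (t p').2 (linv (t p).2)); set h := lmul _ _.
have Ub' : U (f p') by rewrite -fpp'.
have Ubh : U (f (act h p)) by rewrite (pb_invariant pb).
have [_ <-] := tt' p' Ub'; have [_ <-] := tt' _ Ubh.
congr t'; rewrite [LHS]surjective_pairing [RHS]surjective_pairing.
by rewrite !t1 // (pb_invariant pb) fpp' t2 // /h -lmulA lmulV lmul1r.
Qed.

(** Fibres are orbits, and the group acts by isometries that preserve [f], so [fibre_form] is
    constant on fibres. *)
Lemma bundle_reduced_metric_exists g : riemannian_metric g ->
  invariant_tensor act g -> exists h, reduced_metric g f h.
Proof.
move=> rg gi.
apply: (reduced_metric_exists rg bundle_smooth bundle_submersion).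
  move=> p p' /bundle_orbit[h ->]; apply/esym.
  apply: (fibre_form_isometry rg bundle_smooth (msmooth_act MA (pb_action pb) h p)).
  - exact: (mdiff_act_inj MA (pb_action pb)).
  - by move=> q; exact: (pb_invariant pb).
  - by move=> v w; have := congr1 (fun T => T p v w) (gi h).
move=> _ [p _ <-]; have [U [s [oU Ub _ Cs fs]]] := bundle_section p.
by exists U, s.
Qed.

End Bundle.
End Actions.

(** * The quotient *)

Lemma smooth_onS (R : realType) (V W : normedModType R) (A B : set V) (f : V -> W) :
  A `<=` B -> smooth_on B f -> smooth_on A f.
Proof. by move=> AB Cf k; exact: Ck_onS (Cf k). Qed.

Lemma diff_affine (R : realType) (V W : normedModType R) (L : V -> W) (a : W) (x : V) :
  linear L -> continuous L -> 'd (fun y => L y + a) x = L :> (V -> W).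
Proof.
move=> Ll Lc; have [|_ -> //] := approx_diff Ll Lc (f := fun y => L y + a) (x := x).
move=> e e0; near=> y.
have LB u v : L (u - v) = L u - L v by exact: (linearB (linear_of Ll)).
by rewrite LB opprD addrACA subrr addr0 subrr normr0 mulr_ge0 // ltW.
Unshelve. all: by end_near. Qed.

(** * Adjoints of linear maps *)

Section Duality.
Variable R : realType.

Lemma findim_continuous (V W : normedModType R) (L : V -> W) :
  findim V -> linear L -> continuous L.
Proof.
move=> [n [e [c [cc _ cE]]]] Ll x; apply: smooth_near_cont.
pose F := linear_of Ll.
apply: (@near_eq_smooth _ _ _ (fun y => \sum_i c i y *: L (e i))).
  apply: nearW => y; rewrite [in RHS](cE y) -[RHS]/(F _) linear_sum.
  by apply: eq_bigr => i _; rewrite linearZ.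
apply: smooth_near_sum => i; apply: smooth_nearZ; last exact: smooth_near_cst.
by apply: linear_smooth (cc i); exact: linearP.
Qed.

Lemma pairing_dual_map d e (f : 'rV[R]_d -> 'rV[R]_e) a xi : linear f ->
  pairing (dual_map f a) xi = pairing a (f xi).
Proof.
move=> fl; rewrite /pairing (linear_mx fl) -mulmxA; congr ((_ *m _) 0 0).
apply/colP => i; rewrite mxE /pairing (linear_mx fl) -mulmxA -rowE.
by rewrite mxE.
Qed.

Lemma pairing_ext d (a a' : 'cV[R]_d) :
  (forall xi, pairing a xi = pairing a' xi) -> a = a'.
Proof.
move=> h; apply/colP => i; have := h (delta_mx 0 i).
by rewrite /pairing -!rowE !mxE.
Qed.

Lemma dual_map_linear d e (f : 'rV[R]_d -> 'rV[R]_e) : linear (dual_map f).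
Proof.
move=> c a b; apply/colP => i; rewrite !mxE /pairing.
by rewrite linearP !mxE.
Qed.

Lemma dual_map_inj d e (f : 'rV[R]_d -> 'rV[R]_e) : linear f ->
  (forall y, exists x, f x = y) -> injective (dual_map f).
Proof.
move=> fl fs a a' E; apply: pairing_ext => y; have [x <-] := fs y.
by rewrite -!pairing_dual_map // E.
Qed.

Lemma lie_hom1 d e (G : lieGroup R d) (H : lieGroup R e) (f : G -> H) :
  lie_hom f -> f (lone G) = lone H.
Proof.
move=> hf; have := lh_mul hf (lone G) (lone G); rewrite lmul1 => E.
by rewrite -(lmulV (f (lone G))) {3}E lmulA lmulV lmul1.
Qed.

End Duality.

(** * The level set, the differential of [nu] and the pulled back metric *)

Section Quotient.
Variables (R : realType) (d n k m r : nat).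
Variables (G : lieGroup R d) (N : lieGroup R n) (i : N -> G).
Variables (K : lieGroup R k) (pi : G -> K).
Hypotheses (i_hom : lie_hom i) (K_quot : quotient_group i pi).
Variables (Mt : manifold R m) (act : G -> Mt -> Mt) (mu : Mt -> dual R d).
Variable (ct : dual R d).
Hypothesis c_regular :
  regular_value (sub_momentum i mu) (dual_map (lie_map i) ct : dual R n).
Hypothesis mu_principal : principal_bundle act mu.
Variables (Z : manifold R (m - n)%N) (j : Z -> Mt).
Hypothesis Z_level : level_submanifold (sub_momentum i mu)
  (dual_map (lie_map i) ct : dual R n) j.
Variables (M : manifold R r) (q : Z -> M).
Hypothesis M_quot : quotient_manifold i act j q.
Variable nu : M -> dual R k.
Hypothesis nu_smooth : msmooth nu.
Hypothesis nu_red : forall z, ell pi ct (nu (q z)) = mu (j z).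

Let GA := manifold_atlas G.
Let NA := manifold_atlas N.
Let KA := manifold_atlas K.
Let MtA := manifold_atlas Mt.
Let ZA := manifold_atlas Z.
Let MA := manifold_atlas M.

Local Notation ustar := (dual_map (lie_map pi)).

Lemma smooth_j z : msmooth_at j z.
Proof. exact: ((msmoothP _ ZA MtA).1 (emb_smooth Z_level.1)). Qed.

Lemma smooth_q z : msmooth_at q z.
Proof. exact: ((msmoothP _ ZA MA).1 (qm_submersion M_quot).1). Qed.

Lemma smooth_nu p : msmooth_at nu p.
Proof. exact: ((msmoothP _ MA (dual_atlas R k)).1 nu_smooth). Qed.

Lemma q_surj p : exists z, q z = p.
Proof.
have : range q p by rewrite (qm_surj M_quot).
by case=> z _ <-; exists z. Qed.

Lemma ustar_inj : injective ustar.
Proof.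
apply: dual_map_inj; first exact: linearP.
exact: (qg_submersion K_quot).2.
Qed.

(** [pi \o i] is constant, so [u] vanishes on the Lie algebra of [N] and [u^*] takes values in its
    annihilator. *)
Lemma istar_ustar a : dual_map (lie_map i) (ustar a) = 0.
Proof.
apply: pairing_ext => xi.
rewrite pairing_dual_map; last exact: linearP.
rewrite pairing_dual_map; last exact: linearP.
have Ci : msmooth_at i (lone N) by exact: ((msmoothP _ NA GA).1 (lh_smooth i_hom)).
have Cp : msmooth_at pi (i (lone N)).
  exact: ((msmoothP _ GA KA).1 (lh_smooth (qg_hom K_quot))).
have [_ E] := msmooth_comp NA GA Ci Cp.
have := E xi; rewrite (lie_hom1 i_hom) -/(lie_map i) -/(lie_map pi) => <-.
rewrite (_ : pi \o i = fun=> lone K); last first.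
  by apply/funext => x /=; apply/(qg_ker K_quot); exists x.
by rewrite (msmooth_cst _ _).2 /pairing mul0mx mulmx0.
Qed.

Lemma ustar0 : ustar 0 = 0.
Proof. exact: (linear0 (linear_of (dual_map_linear (lie_map pi)))). Qed.

Lemma msmooth_ell y : msmooth_at (ell pi ct) y /\ mdiff (ell pi ct) y = ustar.
Proof.
have Ul := dual_map_linear (lie_map pi).
have Uc := findim_continuous (findim_cV R k) Ul.
have [Cu Du] := msmooth_linear (y : charted_vec 'cV[R]_k) Ul Uc.
have C : smooth_near (ustar \+ cst (ct : 'cV[R]_d)) (y : 'cV[R]_k).
  by apply: smooth_nearD; [exact: Cu.2|exact: smooth_near_cst].
split; first by split; [exact: (smooth_near_cont C)|exact: C].
exact: (diff_affine (ct : 'cV[R]_d) (y : 'cV[R]_k) Ul Uc).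
Qed.

Lemma ell_inj : injective (ell pi ct).
Proof. by move=> y y' /addIr; exact: ustar_inj. Qed.

(** Since [i^*] kills the image of [u^*], all values of [ell] restrict to [c] on the Lie algebra of
    [N]. *)
Lemma mem_level p y : mu p = ell pi ct y -> exists z, j z = p.
Proof.
move=> E; have : range j p.
  rewrite Z_level.2 /= /sub_momentum E /ell.
  have := dual_map_linear (lie_map i) 1 (ustar y) ct.
  by rewrite !scale1r istar_ustar add0r.
by move=> [z _ <-]; exists z.
Qed.

Lemma smooth_sub_momentum p : msmooth_at (sub_momentum i mu) p /\
  forall v, mdiff (sub_momentum i mu) p v = dual_map (lie_map i) (mdiff mu p v).
Proof.
have Il := dual_map_linear (lie_map i).
have [Cl Dl] := msmooth_linear (mu p : charted_vec 'cV[R]_d) Il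
  (findim_continuous (findim_cV R d) Il).
have [C E] := msmooth_comp MtA (dual_atlas R d) (bundle_smooth mu_principal p) Cl.
by split=> // v; have := E v; rewrite Dl.
Qed.

(* A dimension count: both sides of [TZ <= ker dmu_N] have dimension [m - n]. *)
Lemma level_tangent z w :
  dual_map (lie_map i) (mdiff mu (j z) w) = 0 -> exists w', mdiff j z w' = w.
Proof.
move=> w0.
have [Cs Ds] := smooth_sub_momentum (j z).
have jz : sub_momentum i mu (j z) = dual_map (lie_map i) ct.
  by have : range j (j z) by []; rewrite Z_level.2.
pose A := lin1_mx (fun v => (mdiff (sub_momentum i mu) (j z) v)^T).
have AE v : (mdiff (sub_momentum i mu) (j z) v)^T = v *m A.
  exact: (linear_mx (trmx_linear (mdiff_linear (sub_momentum i mu) (j z)))).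
pose J := lin1_mx (mdiff j z).
have JE v : mdiff j z v = v *m J by exact: (linear_mx (mdiff_linear j z)).
have Jf : row_free J.
  apply: inj_row_free => v; rewrite -JE => jv.
  by apply: (emb_immersion Z_level.1 (p := z)); rewrite jv mdiff0.
have Af : row_full A.
  rewrite -sub1mx; apply/row_subP => l; have [v fv] := c_regular jz (row l 1%:M)^T.
  by rewrite -(trmxK (row l _)) -fv AE submxMl.
have JA : J *m A = 0.
  apply/row_matrixP => l; rewrite row_mul row0 rowE -JE -AE.
  have [_ E] := msmooth_comp ZA MtA (smooth_j z) Cs.
  rewrite -E (_ : _ \o j = fun=> dual_map (lie_map i) ct).
    by rewrite (msmooth_cst (M' := dual R n) _ _).2 trmx0.
  by apply/funext => z' /=; have : range j (j z') by []; rewrite Z_level.2.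
have wA : (w <= kermx A)%MS.
  by apply/sub_kermxP; rewrite -AE Ds w0 trmx0.
have JK : (J <= kermx A)%MS by apply/sub_kermxP.
have : (kermx A <= J)%MS.
  have /leqifP := mxrank_leqif_sup JK.
  rewrite (eqP Jf) mxrank_ker (eqP Af).
  by case: ifP => //; rewrite ltnn.
move=> /(submx_trans wA)/submxP[w' ->]; exists w'; exact: JE.
Qed.

(** The derivative of [mu \o j = ell \o nu \o q]; it translates between the kernels of [mdiff mu]
    and [mdiff nu]. *)
Lemma mdiff_mu_level z w :
  mdiff mu (j z) (mdiff j z w) = ustar (mdiff nu (q z) (mdiff q z w)).
Proof.
have [_ E1] := msmooth_comp ZA MtA (smooth_j z) (bundle_smooth mu_principal (j z)).
have [Cnq E2] := msmooth_comp ZA MA (smooth_q z) (smooth_nu (q z)).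
have [Ce De] := msmooth_ell ((nu \o q) z).
have [_ E3] := msmooth_comp ZA (dual_atlas R k) Cnq Ce.
have e : mu \o j = ell pi ct \o (nu \o q).
  by apply/funext => z' /=; rewrite nu_red.
apply: etrans (esym (E1 w)) _.
apply: etrans (congr1 (fun f : Z -> dual R d => mdiff f z w) e) _.
apply: etrans (E3 w) _.
apply: etrans (congr1 (fun L => L _) De) _.
exact: (congr1 ustar (E2 w)).
Qed.

(** A lift of [u^* a] through [mdiff mu] is tangent to the level set because [i^*] kills [u^* a];
    its image under [mdiff q] is the preimage sought, by injectivity of [u^*]. *)
Lemma nu_submersion p a : exists v, mdiff nu p v = a.
Proof.
have [z <-] := q_surj p.
have [w wE] := bundle_submersion mu_principal (j z) (ustar a).
have [w' w'E] : exists w', mdiff j z w' = w.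
  by apply: level_tangent; rewrite wE istar_ustar.
exists (mdiff q z w'); apply: ustar_inj.
by rewrite -mdiff_mu_level w'E.
Qed.

Lemma range_ell y : range nu y -> range mu (ell pi ct y).
Proof. by move=> [p _ <-]; have [z <-] := q_surj p; exists (j z) => //; rewrite nu_red. Qed.

Section Metric.
Variables (gt : tensor2 Mt) (g : tensor2 M).
Hypotheses (rgt : riemannian_metric gt) (rg : riemannian_metric g).
Hypothesis q_riemannian : riemannian_submersion (pullback j gt) g q.

Lemma pullback_inner z : inner_product (pullback j gt z).
Proof.
have [bl bs bp] := metric_inner rgt (j z).
have jl := mdiff_linear j z.
split.
- by split=> a u v w; rewrite /pullback jl ?bl.1 ?bl.2.
- by move=> v w; exact: bs.
- move=> v v0; apply: bp; apply: contra_neq v0 => jv.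
  by apply: (emb_immersion Z_level.1 (p := z)); rewrite jv mdiff0.
Qed.

Lemma horizontal_level z v :
  orthogonal_to_ker (pullback j gt z) (mdiff q z) v ->
  orthogonal_to_ker (g (q z)) (mdiff nu (q z)) (mdiff q z v) ->
  orthogonal_to_ker (gt (j z)) (mdiff mu (j z)) (mdiff j z v).
Proof.
move=> hv hqv w w0.
have [w' w'E] : exists w', mdiff j z w' = w.
  by apply: level_tangent; rewrite w0; exact: (linear0 (linear_of (dual_map_linear _))).
(* [w1] is the [q]-horizontal part of [w']: the remaining vertical part is orthogonal to [v], and
   the isometry property of [q] applies to horizontal vectors only. *)
have [w1 w1E hw1] := orthogonal_lift w' (pullback_inner z) (mdiff_linear q z).
have dnu0 : mdiff nu (q z) (mdiff q z w') = 0.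
  by apply: ustar_inj; rewrite -mdiff_mu_level w'E w0 ustar0.
have [[bl _] bs _] := pullback_inner z.
have bB (u u' : 'rV[R]_(m - n)) : pullback j gt z v (u - u') =
    pullback j gt z v u - pullback j gt z v u'.
  rewrite -!(bs _ v) -scaleN1r addrC bl mulN1r addrC //.
rewrite -w'E -[LHS]/(pullback j gt z v w').
have := hv (w' - w1); rewrite mdiffB w1E subrr => /(_ erefl).
rewrite bB => /eqP; rewrite subr_eq0 => /eqP ->.
have [_ qE] := q_riemannian.
by rewrite -qE // w1E; exact: hqv.
Qed.

Lemma smooth_pullback_ell h : riemannian_metric_on (range mu) h ->
  smooth_tensor_on (range nu) (pullback (ell pi ct) h).
Proof.
move=> rh c -> v w kk /=; apply: Ck_on_local => _ [b [rb _] <-] /=.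
suff [B oB CB] : smooth_near (fun x : 'cV[R]_k => in_chart (pullback (ell pi ct) h)
      (@Chart R 'cV[R]_k 'cV[R]_k setT id id) x v w : R^o) b.
  by exists B => //; exact: CB.
have [p _ pE] := range_ell rb.
(* The section serves to exhibit a neighbourhood [U] of [ell b] inside the image of [mu], where [h]
   is smooth. *)
have [U [s [oU Ub _ _ fs]]] := bundle_section mu_principal p.
have Ch : smooth_near (fun x : 'cV[R]_d => h x (ustar v) (ustar w) : R^o)
    (ell pi ct b).
  exists U; first by rewrite -pE; split.
  apply: (@smooth_onS _ _ _ _ (id @` (range mu `&` setT))).
    by move=> y Uy; exists y => //; split=> //; exists (s y) => //; exact: fs.
  have := rm_smooth rh (erefl : atlas (dual R d) _) (ustar v) (ustar w).
  rewrite /= (_ : (fun x => in_chart _ _ _ _ _) =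
    (fun x : 'cV[R]_d => h x (ustar v) (ustar w) : R^o)) //.
  by apply/funext => x; exact: in_chart_dual.
have [[_ Ce] _] := msmooth_ell b.
have e : (fun x : 'cV[R]_d => h x (ustar v) (ustar w) : R^o) \o
    (ell pi ct : 'cV[R]_k -> 'cV[R]_d) =
    (fun x : 'cV[R]_k => in_chart (pullback (ell pi ct) h)
      (@Chart R 'cV[R]_k 'cV[R]_k setT id id) x v w : R^o).
  apply/funext => y; rewrite in_chart_dual /pullback.
  by have [_ ->] := msmooth_ell y.
by rewrite -e; exact: (smooth_near_comp (findim_cV R d) Ce Ch).
Qed.

Lemma reduced_metric_ell h : reduced_metric gt mu h ->
  reduced_metric g nu (pullback (ell pi ct) h).
Proof.
move=> [rh [_ hE]]; have Ul := dual_map_linear (lie_map pi).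
have pE y v w : pullback (ell pi ct) h y v w = h (ell pi ct y) (ustar v) (ustar w).
  by rewrite /pullback; have [_ ->] := msmooth_ell y.
split; [split|split].
- move=> y /range_ell ry; have [bl br] := rm_bilinear rh ry.
  by split=> a u v w; rewrite !pE Ul ?bl ?br.
- by move=> y /range_ell ry v w; rewrite !pE; exact: (rm_sym rh ry).
- move=> y /range_ell ry v v0; rewrite pE; apply: (rm_pos rh ry).
  by apply: contra_neq v0 => uv; apply: ustar_inj; rewrite uv ustar0.
- exact: smooth_pullback_ell.
- by split; [exact: nu_smooth|exact: nu_submersion].
- move=> p v w; have [z <-] := q_surj p => hv hw.
  have [v' v'E] := (qm_submersion M_quot).2 z v.
  have [w' w'E] := (qm_submersion M_quot).2 z w.
  have [v1 v1E hv1] := orthogonal_lift v' (pullback_inner z) (mdiff_linear q z).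
  have [w1 w1E hw1] := orthogonal_lift w' (pullback_inner z) (mdiff_linear q z).
  have {v'E} v1E : mdiff q z v1 = v by rewrite v1E.
  have {w'E} w1E : mdiff q z w1 = w by rewrite w1E.
  have := hE (j z) (mdiff j z v1) (mdiff j z w1).
  rewrite !mdiff_mu_level pE nu_red v1E w1E => ->.
  + by rewrite -v1E -w1E; exact: esym (q_riemannian.2 _ _ _ hv1 hw1).
  + by apply: horizontal_level => //; rewrite v1E.
  + by apply: horizontal_level => //; rewrite w1E.
Qed.

End Metric.
End Quotient.

(** * The principal bundle of the quotient *)

Section QuotientBundle.
Variables (R : realType) (d n k m r : nat).
Variables (G : lieGroup R d) (N : lieGroup R n) (i : N -> G).
Hypothesis G_compact : compact [set: G].
Variables (K : lieGroup R k) (pi : G -> K).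
Hypotheses (i_hom : lie_hom i) (K_quot : quotient_group i pi).
Variables (Mt : manifold R m) (act : G -> Mt -> Mt) (mu : Mt -> dual R d).
Variable (ct : dual R d).
Hypothesis c_regular :
  regular_value (sub_momentum i mu) (dual_map (lie_map i) ct : dual R n).
Hypothesis mu_principal : principal_bundle act mu.
Variables (Z : manifold R (m - n)%N) (j : Z -> Mt).
Hypothesis Z_level : level_submanifold (sub_momentum i mu)
  (dual_map (lie_map i) ct : dual R n) j.
Variables (M : manifold R r) (q : Z -> M).
Hypothesis M_quot : quotient_manifold i act j q.
Variables (omega : tensor2 M) (actK : K -> M -> M) (nu : M -> dual R k).
Hypothesis omega_sympl : symplectic_form omega.
Hypothesis actK_induced : induced_action pi act j q actK.
Hypothesis hamK : hamiltonian_action omega actK nu.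
Hypothesis nu_red : forall z, ell pi ct (nu (q z)) = mu (j z).

Let GA := manifold_atlas G.
Let KA := manifold_atlas K.
Let MtA := manifold_atlas Mt.
Let ZA := manifold_atlas Z.
Let MA := manifold_atlas M.
Let DA := dual_atlas R k.
Let PA := prod_atlas DA KA.
Let saK := ha_action hamK.
Let Cnu := smooth_nu (ha_smooth hamK).

Lemma pi_surj x : exists h, pi h = x.
Proof.
have : range pi x by rewrite (qg_surj K_quot).
by case=> h _ <-; exists h.
Qed.

(** [mu] is constant along orbits, so all of [G] preserves the level set. *)
Lemma level_act h z : exists z', j z' = act h (j z).
Proof.
apply: (mem_level i_hom K_quot Z_level (y := nu (q z))).
by rewrite (pb_invariant mu_principal) nu_red.
Qed.

(** If [[h]] fixes [[z]], then [h.z = l.z] for some [l] in [N]; freeness of [G] gives [h = l], which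
    is trivial in [K]. *)
Lemma actK_free : free_action actK.
Proof.
move=> x p; have [z <-] := q_surj M_quot p; have [h <-] := pi_surj x.
have [z' z'E] := level_act h z.
rewrite (actK_induced z'E) => /esym/(qm_orbits M_quot)[l lE].
have hl : act h (j z) = act (i l) (j z) by rewrite -z'E.
have : act (lmul (linv (i l)) h) (j z) = j z.
  rewrite (sa_mul (pb_action mu_principal)) hl.
  exact: (act_linvK (pb_action mu_principal)).
move=> /(pb_free mu_principal) e.
have -> : h = i l by rewrite -(lmul1 h) -(lmulVr (i l)) -lmulA e lmul1r.
by apply/(qg_ker K_quot); exists l.
Qed.

Lemma actK_orbit p p' : nu p = nu p' -> exists x, p' = actK x p.
Proof.
have [z <-] := q_surj M_quot p; have [z' <-] := q_surj M_quot p' => e.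
have : mu (j z) = mu (j z') by rewrite -!nu_red e.
move=> /(bundle_orbit mu_principal)[h hE].
by exists (pi h); rewrite (actK_induced hE).
Qed.

Lemma nu_invariant x p : nu (actK x p) = nu p.
Proof.
have [z <-] := q_surj M_quot p; have [h <-] := pi_surj x.
have [z' z'E] := level_act h z.
rewrite (actK_induced z'E); apply: (ell_inj K_quot (ct := ct)).
by rewrite !nu_red z'E (pb_invariant mu_principal).
Qed.

Lemma actK_injl x x' p : actK x p = actK x' p -> x = x'.
Proof.
move=> e; have : actK (lmul (linv x') x) p = p.
  by rewrite (sa_mul saK) e (act_linvK saK).
move=> /actK_free e1.
by rewrite -(lmul1 x) -(lmulVr x') -lmulA e1 lmul1r.
Qed.

Lemma nu_section p0 : exists U (S : dual R k -> M),
  [/\ open U, U (nu p0), forall y, U y -> msmooth_at S y &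
      forall y, U y -> nu (S y) = y].
Proof.
have [z0 <-] := q_surj M_quot p0.
have [V [s [oV Vb _ Cs fs]]] := bundle_section mu_principal (j z0).
rewrite -nu_red in Vb.
pose U := ell pi ct @^-1` V.
have Cell y := (msmooth_ell pi ct y).1.
have oU : open U.
  rewrite openE => y Uy; apply: (Cell y).1.
  by apply: open_nbhs_nbhs.
have ex y : U y -> exists z, j z = s (ell pi ct y).
  by move=> Uy; apply: (mem_level i_hom K_quot Z_level (y := y)); exact: fs.
(* The section of [mu] over [ell y] lies on the level set, so it comes from [Z]; [z0] is a dummy
   value off [U]. *)
pose sg y := if pselect (exists z, j z = s (ell pi ct y)) is left e
  then projT1 (cid e) else z0.
have sgE y : U y -> j (sg y) = s (ell pi ct y).
  move=> /ex e; rewrite /sg; case: pselect => [e'|//].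
  exact: (projT2 (cid e')).
have nU y : U y -> \forall y' \near y, U y' by move=> Uy; apply: open_nbhs_nbhs.
have Cse y : U y -> msmooth_at (s \o ell pi ct) y.
  by move=> Uy; have [] := msmooth_comp DA (dual_atlas R d) (Cell y) (Cs _ Uy).
(* The topology of [Z] is the one induced by [j], and [j \o sg] is continuous. *)
have csg y : U y -> {for y, continuous sg}.
  move=> Uy A; rewrite nbhsE => -[B [oB By] BA].
  have [W oW BW] := emb_top Z_level.1 oB.
  have nW : nbhs (s (ell pi ct y)) W.
    by apply: open_nbhs_nbhs; split=> //; rewrite -sgE //; rewrite BW in By.
  have n1 : \forall y' \near y, W (s (ell pi ct y')) := (Cse y Uy).1 _ nW.
  have n2 := nU y Uy.
  suff : \forall y' \near y, A (sg y') by [].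
  apply: filterS2 n1 n2 => y' Wy' Uy'.
  by apply: BA; rewrite BW /= sgE.
have Csg y : U y -> msmooth_at sg y.
  move=> Uy; apply: (msmooth_lift DA ZA MtA (F := j)).
  - by apply: filterS (nU y Uy) => y'; exact: csg.
  - exact: smooth_j Z_level _.
  - have ne : \forall y' \near y, (s \o ell pi ct) y' = (j \o sg) y'.
      by apply: filterS (nU y Uy) => y' Uy' /=; rewrite sgE.
    by have [] := near_eq_msmooth DA ne (Cse y Uy).
  - exact: emb_immersion Z_level.1 _.
exists U, (q \o sg); split => //.
  move=> y Uy; have Cq := smooth_q M_quot (sg y).
  by have [] := msmooth_comp DA ZA (Csg y Uy) Cq.
move=> y Uy; apply: (ell_inj K_quot (ct := ct)).
by rewrite nu_red /= sgE // fs.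
Qed.

Lemma K_compact : compact [set: K].
Proof.
rewrite -(qg_surj K_quot); apply: continuous_compact => //.
apply: continuous_subspaceT => h.
by have [] := (msmoothP _ GA KA).1 (lh_smooth (qg_hom K_quot)) h.
Qed.

(* Closed graph: the fibre coordinate takes its values in the compact group [K],
   and its graph is closed because [M] is Hausdorff. *)
Lemma fibre_coord_cont (S : dual R k -> M) (kap : M -> K) p :
  msmooth_at S (nu p) -> (\forall p' \near p, actK (kap p') (S (nu p')) = p') ->
  {for p, continuous kap}.
Proof.
move=> CS kapE A; rewrite nbhsE => -[B [oB By] BA].
have kp := nbhs_singleton kapE.
have cK : compact (~` B).
  apply: (subclosed_compact _ K_compact) => //; exact: open_closedC.
(* For [x] outside [B], freeness makes [p] and [x.S(nu p)] distinct. Disjoint neighbourhoods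
   separate them, and continuity of the action and of [S \o nu] spreads this to [x'] near [x] and
   [p'] near [p]. *)
have cov x : (~` B) x -> \forall x' \near x & p' \near nbhs p,
    p' <> actK x' (S (nu p')).
  move=> Bx; set p1 := actK x (S (nu p)).
  have pp1 : p <> p1.
    move=> e; apply: Bx; rewrite -(@actK_injl (kap p) x (S (nu p))) //.
    by rewrite kp.
  have [A1 [A2 [n1 n2 A12]]] : exists A1 A2, [/\ nbhs p A1, nbhs p1 A2 &
      A1 `&` A2 = set0].
    apply: contrapT => h; apply: pp1; apply: (@mhausdorff _ _ M) => A1 A2 n1 n2.
    by apply/set0P/eqP => A0; apply: h; exists A1, A2.
  have cSn : {for p, continuous (fun p' => S (nu p'))}.
    by have [[cc _] _] := msmooth_comp MA DA (Cnu p) CS.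
  have [[B1 B2] /= [m1 m2] B12] := (msmooth_action MA saK x (S (nu p))).1 _ n2.
  exists (B1, [set p' | A1 p' /\ B2 (S (nu p'))]) => /=.
    split=> //; have m3 : \forall p' \near p, B2 (S (nu p')) := cSn _ m2.
    by apply: filterS2 n1 m3 => p' A1p' B2p'; split.
  move=> [x' p'] /= [B1x' [A1p' B2p']] e.
  have A2p' : A2 p' by rewrite e; exact: (B12 (x', S (nu p')) (conj B1x' B2p')).
  by have : (A1 `&` A2) p' by []; rewrite A12.
(* Compactness of the complement of [B] makes the neighbourhood of [p] uniform in [x], so [kap p']
   cannot leave [B]. *)
have ncov : \forall p' \near p, forall x, (~` B) x -> p' <> actK x (S (nu p')).
  exact: (compact_near_coveringP _).1 cK _ (nbhs p)
    (fun p' x => p' <> actK x (S (nu p'))) _ cov.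
suff : \forall p' \near p, A (kap p') by [].
apply: filterS2 ncov kapE => p' h kp'; apply: BA.
by apply: contrapT => Bk; apply: (h _ Bk); rewrite kp'.
Qed.

Lemma quotient_bundle : principal_bundle actK nu.
Proof.
split => //.
- exact: actK_free.
- exact: ha_smooth hamK.
- exact: nu_invariant.
move=> _ [p0 _ <-]; have [U [S [oU Ub CS nuS]]] := nu_section p0.
have fib p : U (nu p) -> exists x, p = actK x (S (nu p)).
  by move=> Up; apply: actK_orbit; rewrite nuS.
pose kap p : K := if pselect (exists x, p = actK x (S (nu p))) is left e
  then projT1 (cid e) else lone K.
have kapE p : U (nu p) -> actK (kap p) (S (nu p)) = p.
  move=> /fib e; rewrite /kap; case: pselect => [e'|//].
  exact: esym (projT2 (cid e')).
pose t p : charted_prod (dual R k) K := (nu p, kap p).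
pose t' (u : charted_prod (dual R k) K) : M := actK u.2 (S u.1).
have oUK : open (U `*` setT : set (charted_prod (dual R k) K)).
  by apply: open_setM => //; exact: openT.
have onU : open (nu @^-1` U).
  rewrite openE => p Up; apply: (Cnu p).1.
  by apply: open_nbhs_nbhs.
have nuU p : U (nu p) -> \forall p' \near p, U (nu p').
  by move=> Up; apply: (Cnu p).1; apply: open_nbhs_nbhs.
have nUK (u : charted_prod (dual R k) K) : U u.1 -> \forall u' \near u, U u'.1.
  move=> Uu; have : nbhs u (U `*` setT : set (charted_prod (dual R k) K)).
    by apply: open_nbhs_nbhs.
  by apply: filterS => u' [].
have Ct' u : U u.1 -> msmooth_at t' u.
  move=> Uu.
  have [C1 _] := msmooth_fst (M2 := K) DA (u : charted_prod (dual R k) K).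
  have [C2 _] := msmooth_snd (M1 := dual R k) KA (u : charted_prod (dual R k) K).
  have [CS1 _] := msmooth_comp PA DA C1 (CS _ Uu).
  have [Cp _] := msmooth_pair C2 CS1.
  by have [] := msmooth_comp (f := fun u : charted_prod (dual R k) K =>
    (u.2, S u.1) : charted_prod K M) PA (prod_atlas KA MA) Cp
    (msmooth_action MA saK _ _).
have nut' u : U u.1 -> nu (t' u) = u.1.
  by move=> Uu; rewrite /t' nu_invariant nuS.
have t'K u : U u.1 -> t (t' u) = u.
  move=> Uu; rewrite /t nut' //; case: u Uu => y x /= Uy; congr (_, _).
  apply: (@actK_injl _ _ (S y)).
  have := @kapE (t' (y, x)); rewrite nut' //= => -> //.
have cont_t p : U (nu p) -> {for p, continuous t}.
  move=> Up; have c2 : {for p, continuous kap}.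
    apply: (fibre_coord_cont (S := S)); first exact: CS.
    by apply: filterS (nuU p Up) => p'; exact: kapE.
  exact: (cvg_pair (Cnu p).1 c2).
(* [nu \o t'] is the first projection, so a kernel vector is tangent to the factor [K]. There [t']
   is an orbit map, an immersion because [nu] is a submersion satisfying the moment map equation. *)
have t'_inj u : U u.1 -> injective (mdiff t' u).
  move=> Uu; apply: mdiff_inj => v v0.
  have v1 : v.1 = 0.
    have [C1 D1] := msmooth_fst (M2 := K) DA (u : charted_prod (dual R k) K).
    have [_ E1] := msmooth_comp PA MA (Ct' u Uu) (Cnu (t' u)).
    have ne : \forall u' \near u, u'.1 = (nu \o t') u'.
      by apply: filterS (nUK u Uu) => u' Uu' /=; rewrite nut'.
    have [_ E2] := near_eq_msmooth PA ne C1.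
    by rewrite -D1 -E2 E1 v0 mdiff0.
  have vE : v = (0, v.2) by rewrite -v1 -surjective_pairing.
  suff v2 : v.2 = 0 by rewrite vE v2.
  case: u Uu v0 => y x /= Uy v0.
  have Cs : msmooth_at (fun x' : K => (y, x') : charted_prod (dual R k) K) x /\
      forall w, mdiff (fun x' : K => (y, x') : charted_prod (dual R k) K) x w = (0, w).
    have [Cc Dc] := msmooth_cst (M := K) (y : dual R k) x.
    have [Ci Di] := msmooth_id x KA.
    have [Cp Dp] := msmooth_pair Cc Ci.
    by split=> // w; rewrite Dp Dc Di.
  have [_ E1] := msmooth_comp KA PA Cs.1 (Ct' (y, x) Uy).
  have orb : mdiff (fun x' : K => actK x' (S y) : M) x v.2 = 0.
    by have := E1 v.2; rewrite Cs.2 -vE v0.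
  have oi : injective (mdiff (fun x' : K => actK x' (S y) : M) x).
    apply: (mdiff_orbit_inj MA saK); apply: (moment_inj omega_sympl hamK).
    exact: (nu_submersion i_hom K_quot c_regular mu_principal Z_level M_quot
      (ha_smooth hamK) nu_red).
  by apply: oi; rewrite orb mdiff0.
(* [t] is a continuous lift of the identity through the immersion [t']. *)
have Ct p : U (nu p) -> msmooth_at t p.
  move=> Up; apply: (msmooth_lift MA PA MA (F := t')).
  - by apply: filterS (nuU p Up) => p'; exact: cont_t.
  - exact: Ct'.
  - have ne : \forall p' \near p, p' = (t' \o t) p'.
      by apply: filterS (nuU p Up) => p' Up'; rewrite /= /t' /t /= kapE.
    have [Ci _] := msmooth_id p MA.
    by have [] := near_eq_msmooth (f := id) MA ne Ci.
  - exact: t'_inj.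
exists U, t, t'; split => //.
  split => //.
  - by move=> p Up; split=> //; exact: kapE.
  - by move=> u [Uu _]; split; [rewrite /= nut'|exact: t'K].
  - exact/(msmooth_onP _ MA PA onU).
  - by apply/(msmooth_onP _ PA MA oUK) => u [Uu _]; exact: Ct'.
move=> x p Up; apply: (@actK_injl _ _ (S (nu p))).
rewrite (sa_mul saK) kapE // -[RHS](@kapE (actK x p)) ?nu_invariant //.
Qed.

End QuotientBundle.

Theorem lemma2 (R : realType) (d n m : nat)
    (G : lieGroup R d) (G_compact : compact [set: G])
    (N : lieGroup R n) (i : N -> G) (N_sub : closed_normal_subgroup i)
    (K : lieGroup R (d - n)%N) (pi : G -> K) (K_quot : quotient_group i pi)
    (Mt : manifold R m) (omegat : tensor2 Mt) (omegat_sympl : symplectic_form omegat)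
    (act : G -> Mt -> Mt) (mu : Mt -> dual R d)
    (ham : hamiltonian_action omegat act mu)
    (ct : dual R d) (ct_inv : forall g : G, coAd g ct = ct)
    (c_regular :
       regular_value (sub_momentum i mu) (dual_map (lie_map i) ct : dual R n))
    (N_locally_free :
       locally_free_on (sub_momentum i mu @^-1` [set dual_map (lie_map i) ct])
         (fun h : N => act (i h)))
    (G_free : free_action act) (dim_half : (d.*2 = m)%N)
    (mu_principal : principal_bundle act mu)
    (gt : tensor2 Mt) (gt_kahler : kahler_metric omegat gt)
    (gt_inv : invariant_tensor act gt)
    (Z : manifold R (m - n)%N) (j : Z -> Mt)
    (Z_level : level_submanifold (sub_momentum i mu)
                 (dual_map (lie_map i) ct : dual R n) j)
    (M : manifold R (m - n.*2)%N) (q : Z -> M) (M_quot : quotient_manifold i act j q)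
    (omega : tensor2 M) (omega_sympl : symplectic_form omega)
    (omega_red : pullback q omega = pullback j omegat)
    (g : tensor2 M) (g_metric : riemannian_metric g)
    (q_riemannian : riemannian_submersion (pullback j gt) g q)
    (actK : K -> M -> M) (actK_induced : induced_action pi act j q actK)
    (nu : M -> dual R (d - n)%N) (hamK : hamiltonian_action omega actK nu)
    (nu_red : forall z, ell pi ct (nu (q z)) = mu (j z)) :
  [/\ unique_reduced_metric gt mu,
      free_action actK,
      principal_bundle actK nu /\ unique_reduced_metric g nu,
      (forall y, range nu y -> range mu (ell pi ct y)) &
      forall gt_red g_red : tensor2 _,
        reduced_metric gt mu gt_red -> reduced_metric g nu g_red ->
        forall y, range nu y -> forall v w,
          pullback (ell pi ct) gt_red y v w = g_red y v w].

Proof.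
have i_hom := cns_hom N_sub.
have rgt := gt_kahler.1.
have smu := bundle_submersion mu_principal.
have nu_smooth := ha_smooth hamK.
have snu := nu_submersion i_hom K_quot c_regular mu_principal Z_level M_quot
  nu_smooth nu_red.
have Cnu := smooth_nu nu_smooth.
have Cmu := bundle_smooth mu_principal.
have red_ell := reduced_metric_ell i_hom K_quot c_regular mu_principal Z_level
  M_quot nu_smooth nu_red rgt q_riemannian.
have [h0 h0_red] := bundle_reduced_metric_exists mu_principal rgt gt_inv.
split.
- exists h0 => // h' h'_red.
  exact: (reduced_metric_unique rgt smu h0_red h'_red).
- exact: (actK_free i_hom K_quot mu_principal Z_level M_quot actK_induced nu_red).
- split.
    exact: (quotient_bundle G_compact i_hom K_quot c_regular mu_principal Z_level
      M_quot omega_sympl actK_induced hamK nu_red).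
  exists (pullback (ell pi ct) h0); first exact: red_ell.
  move=> h' h'_red.
  exact: (reduced_metric_unique g_metric snu (red_ell _ h0_red) h'_red).
- exact: (range_ell M_quot nu_red).
- move=> gt_red g_red gt_redE g_redE y ry v w.
  (* Both sides are reduced metrics for [nu], so uniqueness on its image concludes. *)
  exact: (reduced_metric_unique g_metric snu g_redE (red_ell _ gt_redE) ry).
Qed.
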